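(* Let $(G_0,\mathfrak{g})$ be a super Harish-Chandra pair and $U\subseteq G_0$ open. For every $a\in\mathfrak{g}_{\bar1}$ and (homogeneous) $f\in\mathrm{Hom}_{\mathbb{R}}(\Lambda(\mathfrak{g}_{\bar1}),\mathcal{C}^\infty(U))$, $$\hat\varphi(a)(f)=\theta_1^{\mathrm{Ad}_{g^{-1}}a}*f+(-1)^{|f|}f\circ\bigl(\epsilon^{\mathrm{Ad}_{g^{-1}}a}*\mathrm{Id}_{\Lambda(\mathfrak{g}_{\bar1})}\bigr),$$ where the convolution product $\theta_1^{\mathrm{Ad}_{g^{-1}}a}*f$ is defined via the map $\varphi_0:\mathfrak{g}_{\bar0}\to\mathcal{T}(G_0)$, and the right-hand side is understood at each point $g\in U$.
   Context: A super Harish-Chandra pair $(G_0,\mathfrak{g})$ consists of a Lie group $G_0$ and a (real, finite-dimensional) Lie superalgebra $\mathfrak{g}=\mathfrak{g}_{\bar0}+\mathfrak{g}_{\bar1}$ with $\mathfrak{g}_{\bar0}=\mathrm{Lie}(G_0)$, and a morphism $\mathrm{Ad}:G_0\to\mathrm{Aut}(\mathfrak{g})$ extending the adjoint action on $\mathfrak{g}_{\bar0}$ whose differential is $\mathrm{ad}|_{\mathfrak{g}_{\bar0}}$; it is extended to $\mathcal{U}(\mathfrak{g})$. $\varphi_0:\mathfrak{g}_{\bar0}\to\mathcal{T}(G_0)$ is the representation by left-invariant vector fields, $(\varphi_0(b)k)(g)=\frac{d}{dt}|_0k(g\exp(tb))$; it makes $\mathcal{C}^\infty(U)$ a left $\mathcal{U}(\mathfrak{g}_{\bar0})$-module.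 The structure sheaf of the associated Lie supergroup is $\mathcal{A}_G(U)=\mathrm{Hom}_{\mathcal{U}(\mathfrak{g}_{\bar0})}(\mathcal{U}(\mathfrak{g}),\mathcal{C}^\infty(U))$ with the convolution product. The representation by right-invariant vector fields is $(\hat\varphi(a)F)(u)(g)=(-1)^{|F||a|}F((\mathrm{Ad}_{g^{-1}}a)\cdot u)(g)$. With $\gamma:\Lambda(\mathfrak{g}_{\bar1})\to\mathcal{U}(\mathfrak{g})$, $\gamma(a_1\wedge\dots\wedge a_p)=\frac1{p!}\sum_\sigma\mathrm{sgn}(\sigma)a_{\sigma(1)}\cdots a_{\sigma(p)}$, the map $F\mapsto f=F\circ\gamma$ is an isomorphism $\mathcal{A}_G(U)\cong\mathrm{Hom}_{\mathbb{R}}(\Lambda(\mathfrak{g}_{\bar1}),\mathcal{C}^\infty(U))$, through which $\hat\varphi(a)$ acts on $f$ (that is, $\hat\varphi(a)(f):=(\hat\varphi(a)F)\circ\gamma$). Let $b_{p}$ be the Bernoulli numbers ($\frac{t}{e^t-1}=\sum_p b_p\frac{t^p}{p!}$). For $a\in\mathfrak{g}_{\bar1}$ define the odd linear maps $\theta_1^a:\Lambda(\mathfrak{g}_{\bar1})\to\mathfrak{g}_{\bar0}$ and $\epsilon^a:\Lambda(\mathfrak{g}_{\bar1})\to\mathfrak{g}_{\bar1}$: $\theta_1^a$ vanishes on $\Lambda^{even}$ and $$\theta_1^a(a_1\wedge\dots\wedge a_{2p-1})=\sum_{\sigma\in\Sigma_{2p-1}}\frac{b_{2p}(2^{2p+1}-2)}{(2p)!}\,\mathrm{sgn}(\sigma)\,\mathrm{ad}\,a_{\sigma(1)}\circ\dots\circ\mathrm{ad}\,a_{\sigma(2p-1)}(a),$$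 and $\epsilon^a$ vanishes on $\Lambda^{odd}$ and $$\epsilon^a(a_1\wedge\dots\wedge a_{2p})=\sum_{\sigma\in\Sigma_{2p}}\frac{b_{2p}(-2^{2p+1}+2^{2p}+2)}{(2p)!}\,\mathrm{sgn}(\sigma)\,\mathrm{ad}\,a_{\sigma(1)}\circ\dots\circ\mathrm{ad}\,a_{\sigma(2p)}(a)$$ (so $\epsilon^a(1)=a$). Writing $\Delta(v)=v_{(1)}\otimes v_{(2)}$ for the coproduct of the Hopf superalgebra $\Lambda(\mathfrak{g}_{\bar1})$ (elements of $\mathfrak{g}_{\bar1}$ odd and primitive), the convolutions are taken with the sign rule $(P\otimes Q)(x\otimes y)=(-1)^{|Q||x|}P(x)\otimes Q(y)$: $(\epsilon^{a}*\mathrm{Id})(v)=\epsilon^{a}(v_{(1)})\wedge v_{(2)}$ and $(\theta_1^{\mathrm{Ad}_{g^{-1}}a}*f)(v)(g)=(-1)^{|f||v_{(1)}|}\bigl(\varphi_0(\theta_1^{\mathrm{Ad}_{g^{-1}}a}(v_{(1)}))f(v_{(2)})\bigr)(g)$. *)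

(* Defs.v *)
From HB Require Import structures.
From mathcomp Require Import all_boot all_order all_algebra monoid perm.
From mathcomp Require Import all_classical all_reals all_analysis.

Set Implicit Arguments.
Unset Strict Implicit.
Unset Printing Implicit Defensive.

Import Order.TTheory GRing.Theory Num.Theory.
Import numFieldNormedType.Exports.

Local Open Scope classical_set_scope.
Local Open Scope ring_scope.

(* C^k on an open subset W of R^n, via iterated partial derivatives; the values
   of f outside W are irrelevant. *)
Fixpoint Ck (R : realType) (n k : nat) (W : set 'rV[R]_n) (f : 'rV[R]_n -> R) :
    Prop :=
  (forall x, W x -> {for x, continuous f}) /\
  if k is k'.+1 then
    forall i : 'I_n, (forall x, W x -> derivable f x (delta_mx 0 i)) /\
                     Ck k' W (fun x => 'D_(delta_mx 0 i) f x)
  else True.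

Definition Coo (R : realType) (n : nat) (W : set 'rV[R]_n)
  (f : 'rV[R]_n -> R) : Prop := forall k, Ck k W f.

Record chart (R : realType) (n : nat) (T : topologicalType) := Chart {
  cdom : set T;
  cmap : T -> 'rV[R]_n;
  cinv : 'rV[R]_n -> T }.

Definition cimg (R : realType) (n : nat) (T : topologicalType)
  (c : chart R n T) : set 'rV[R]_n := cmap c @` cdom c.

Definition is_chart (R : realType) (n : nat) (T : topologicalType)
    (c : chart R n T) : Prop :=
  [/\ open (cdom c), open (cimg c),
      forall x, cdom c x -> cinv c (cmap c x) = x,
      {within cdom c, continuous (cmap c)} &
      {within cimg c, continuous (cinv c)}].

Definition is_atlas (R : realType) (n : nat) (T : topologicalType)
    (A : set (chart R n T)) : Prop :=
  [/\ forall c, A c -> is_chart c,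
      forall x, exists2 c, A c & cdom c x &
      forall c d, A c -> A d -> forall i,
        Coo (cmap c @` (cdom c `&` cdom d))
            (fun w => cmap d (cinv c w) 0 i)].

HB.mixin Record isLieGroup (R : realType) (n : nat) G
    of Group G & Topological G := {
  atlas : set (chart R n G);
  atlasP : is_atlas atlas;
  lie_hausdorff : hausdorff_space G;
  lie_second_countable : @second_countable G;
  lie_mul_continuous : continuous (fun xy : G * G => (xy.1 * xy.2)%g);
  lie_inv_continuous : continuous (fun x : G => x^-1%g);
  lie_mul_smooth : forall c1 c2 c3, atlas c1 -> atlas c2 -> atlas c3 ->
    forall i, Coo
      [set w : 'rV[R]_(n + n) |
        [/\ cimg c1 (lsubmx w), cimg c2 (rsubmx w) &
            cdom c3 (cinv c1 (lsubmx w) * cinv c2 (rsubmx w))%g]]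
      (fun w => cmap c3 (cinv c1 (lsubmx w) * cinv c2 (rsubmx w))%g 0 i);
  lie_inv_smooth : forall c1 c2, atlas c1 -> atlas c2 ->
    forall i, Coo (cmap c1 @` [set x | cdom c1 x /\ cdom c2 x^-1%g])
                  (fun w => cmap c2 (cinv c1 w)^-1%g 0 i) }.

#[short(type="lieGroupType")]
HB.structure Definition LieGroup (R : realType) (n : nat) :=
  { G of isLieGroup R n G & Group G & Topological G }.

Section SmoothFunctions.
Variables (R : realType) (n : nat) (G : lieGroupType R n).
Implicit Types (k l : G -> R) (U : set G).

Definition smooth_on U k : Prop :=
  forall c : chart R n G, atlas c -> Coo (cmap c @` (cdom c `&` U)) (k \o cinv c).

(* An element of C^oo(U) is represented by its extension by 0 to G. *)
Definition Cinfty U k : Prop := smooth_on U k /\ forall x, ~ U x -> k x = 0.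

Definition left_invariant_vf (X : (G -> R) -> (G -> R)) : Prop :=
  [/\ forall k, smooth_on setT k -> smooth_on setT (X k),
      forall (c : R) k l, smooth_on setT k -> smooth_on setT l ->
        X (fun x => c * k x + l x) = (fun x => c * X k x + X l x),
      forall k l, smooth_on setT k -> smooth_on setT l ->
        X (fun x => k x * l x) = (fun x => X k x * l x + k x * X l x) &
      forall (h : G) k, smooth_on setT k ->
        X (fun x => k (h * x)%g) = (fun x => X k (h * x)%g)].

End SmoothFunctions.

Record lie_superalgebra (R : realType) (g : vectType R) := LieSuperalgebra {
  part : bool -> {vspace g}; (* true is the odd part *)
  part_sum : (part false + part true = fullv)%VS;
  part_cap : (part false :&: part true = 0)%VS;
  br : g -> g -> g;
  br_linl : forall z (c : R) x y, br (c *: x + y) z = c *: br x z + br y z;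
  br_linr : forall z (c : R) x y, br z (c *: x + y) = c *: br z x + br z y;
  br_part : forall p q x y, x \in part p -> y \in part q ->
    br x y \in part (p (+) q);
  br_anti : forall p q x y, x \in part p -> y \in part q ->
    br x y = - ((-1) ^+ (p && q) *: br y x);
  br_jacobi : forall p q x y z, x \in part p -> y \in part q ->
    br x (br y z) = br (br x y) z + (-1) ^+ (p && q) *: br y (br x z) }.

(* Lie(G) is the Lie algebra of left-invariant vector fields on G; the
   identification of the even part with Lie(G) is the isomorphism lie_vf.
   Conjugation by h on left-invariant fields is read off at the unit. *)
Record harish_chandra (R : realType) (n : nat) (G : lieGroupType R n)
    (g : vectType R) := HarishChandra {
  hc_alg :> lie_superalgebra g;
  lie_vf : g -> (G -> R) -> (G -> R);
  lie_vf_inv : forall b, b \in part hc_alg false -> left_invariant_vf (lie_vf b);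
  lie_vf_lin : forall (c : R) b b' k,
    b \in part hc_alg false -> b' \in part hc_alg false -> smooth_on setT k ->
    lie_vf (c *: b + b') k = (fun x => c * lie_vf b k x + lie_vf b' k x);
  lie_vf_bij : forall X, left_invariant_vf X ->
    exists! b, b \in part hc_alg false /\
               forall k, smooth_on setT k -> X k = lie_vf b k;
  lie_vf_br : forall b b' k,
    b \in part hc_alg false -> b' \in part hc_alg false -> smooth_on setT k ->
    lie_vf (br hc_alg b b') k =
      (fun x => lie_vf b (lie_vf b' k) x - lie_vf b' (lie_vf b k) x);
  Ad : G -> g -> g;
  Ad_lin : forall h (c : R) x y, Ad h (c *: x + y) = c *: Ad h x + Ad h y;
  Ad_part : forall h p x, x \in part hc_alg p -> Ad h x \in part hc_alg p;
  Ad_br : forall h x y, Ad h (br hc_alg x y) = br hc_alg (Ad h x) (Ad h y);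
  Ad_1 : forall x, Ad 1%g x = x;
  Ad_mul : forall h h' x, Ad (h * h')%g x = Ad h (Ad h' x);
  Ad_smooth : forall (l : {linear g -> R^o}) x,
    smooth_on setT (fun h => l (Ad h x) : R);
  Ad_even : forall h b k, b \in part hc_alg false -> smooth_on setT k ->
    lie_vf (Ad h b) k 1%g = lie_vf b (fun x => k (h * x * h^-1)%g) 1%g;
  Ad_diff : forall (l : {linear g -> R^o}) b x, b \in part hc_alg false ->
    lie_vf b (fun h => l (Ad h x)) 1%g = l (br hc_alg b x) }.

Section ExpPhi0.
Variables (R : realType) (n : nat) (G : lieGroupType R n) (g : vectType R).
Variable H : harish_chandra G g.

Definition one_param (b : g) (c : R -> G) : Prop :=
  [/\ continuous c, forall s t, c (s + t) = (c s * c t)%g &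
      forall k, smooth_on setT k ->
        is_derive (0 : R) 1 (fun t => k (c t)) (lie_vf H b k 1%g)].

(* The one-parameter subgroup with velocity b exists and is unique. *)
Definition lie_exp (b : g) : G :=
  xget 1%g [set x | exists2 c, one_param b c & x = c 1].

Definition phi0 (b : g) (k : G -> R) : G -> R :=
  fun x => derive1 (fun t : R => k (x * lie_exp (t *: b))%g) 0.

End ExpPhi0.

Section Enveloping.
Variables (R : realType) (g : vectType R) (L : lie_superalgebra g).

Definition super_rep (A : algType R) (j : g -> A) : Prop :=
  (forall (c : R) x y, j (c *: x + y) = c *: j x + j y) /\
  forall p q x y, x \in part L p -> y \in part L q ->
    j x * j y - (-1) ^+ (p && q) *: (j y * j x) = j (br L x y).

Definition is_enveloping (Ug : algType R) (iU : g -> Ug) : Prop :=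
  super_rep iU /\
  forall (A : algType R) (j : g -> A), super_rep j ->
    exists2 h : {lrmorphism Ug -> A}, forall x, h (iU x) = j x &
      forall h' : {lrmorphism Ug -> A}, (forall x, h' (iU x) = j x) -> h' =1 h.

End Enveloping.

(* Coordinates on the monomials e_S, the increasing products of the e_i, i in S,
   where e = vbasis W. *)
Notation Lambda R W := {ffun {set 'I_(\dim W)} -> R^o}.

(* The super tensor product of Lambda R W with itself, on the e_S (x) e_T. *)
Notation Lambda2 R W :=
  {ffun {set 'I_(\dim W)} * {set 'I_(\dim W)} -> R^o}.

Section Exterior.
Variables (R : realType) (V : vectType R) (W : {vspace V}).

Local Notation I := 'I_(\dim W).
Local Notation Lam := (Lambda R W).
Local Notation Lam2 := (Lambda2 R W).

Definition mon (S : {set I}) : Lam := [ffun T => (T == S)%:R].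

Definition inversions (S T : {set I}) : nat :=
  #|[pred ij : I * I | [&& ij.1 \in S, ij.2 \in T & (ij.2 < ij.1)%N]]|.

Definition wedge (u v : Lam) : Lam :=
  \sum_(S : {set I}) \sum_(T : {set I} | [disjoint S & T])
    ((-1) ^+ inversions S T * (u S * v T)) *: mon (S :|: T).

Definition lam1 : Lam := mon finset.set0.

Definition vec (x : V) : Lam := \sum_i coord (vbasis W) i x *: mon [set i]%SET.

Definition wedges (s : seq V) : Lam := \big[wedge/lam1]_(x <- s) vec x.

(* The linear map x_1 /\ ... /\ x_p |-> h [:: x_1; ...; x_p], for h alternating
   and multilinear (lin_ext_wedges below; applied in gamma_wedges,
   theta1_wedges and epsilon_wedges). *)
Definition lin_ext (A : lmodType R) (h : seq V -> A) (v : Lam) : A :=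
  \sum_S v S *: h [seq (vbasis W)`_i | i : I <- enum S].

Definition tens (u v : Lam) : Lam2 := [ffun p => u p.1 * v p.2].

Definition tmul (s t : Lam2) : Lam2 :=
  \sum_(p : {set I} * {set I}) \sum_(q : {set I} * {set I})
    ((-1) ^+ (#|p.2| * #|q.1|) * (s p * t q)) *:
      tens (wedge (mon p.1) (mon q.1)) (wedge (mon p.2) (mon q.2)).

(* The algebra morphism for which the elements of W are primitive. *)
Definition coprod : Lam -> Lam2 :=
  lin_ext (fun s => \big[tmul/tens lam1 lam1]_(x <- s)
                      (tens (vec x) lam1 + tens lam1 (vec x))).

(* m o (P (x) Q) o coprod, with m bilinear and q the parity of Q. *)
Definition convolution (A B C : lmodType R) (m : A -> B -> C)
    (P : Lam -> A) (q : bool) (Q : Lam -> B) (v : Lam) : C :=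
  \sum_(p : {set I} * {set I})
    ((-1) ^+ (q * #|p.1|) * coprod v p) *: m (P (mon p.1)) (Q (mon p.2)).

Definition antisym (A : lmodType R) (h : seq V -> A) (s : seq V) : A :=
  \sum_(t : 'S_(size s)) (-1) ^+ t *: h [seq s`_(t i) | i <- enum 'I_(size s)].

End Exterior.

Definition multilinear (R : realType) (V A : lmodType R) (h : seq V -> A) : Prop :=
  forall (c : R) x y s1 s2,
    h (s1 ++ (c *: x + y) :: s2) = c *: h (s1 ++ x :: s2) + h (s1 ++ y :: s2).

Definition alternating (R : realType) (V A : lmodType R) (h : seq V -> A) : Prop :=
  forall x y s1 s2, h (s1 ++ x :: y :: s2) = - h (s1 ++ y :: x :: s2).

Section ExteriorFacts.
Variables (R : realType) (V : vectType R) (W : {vspace V}).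
Local Notation I := 'I_(\dim W).
Local Notation Lam := (Lambda R W).
Local Notation base := (fun i : I => (vbasis W)`_i).

Section Ext.
Variables (A : lmodType R) (h : seq V -> A).
Hypotheses (hlin : multilinear h) (halt : alternating h).

Lemma ml_sum t s (J : finType) (c : J -> R) (x : J -> V) :
  h (t ++ (\sum_j c j *: x j) :: s) = \sum_j c j *: h (t ++ x j :: s).
Proof.
have h0 : h (t ++ 0 :: s) = 0.
  by have := hlin 1 0 0 t s; rewrite !scale1r addr0 -[LHS]addr0 => /addrI.
elim/big_rec2: _ => [//|j y z _ <-]; exact: hlin.
Qed.

Lemma alt_move t x s u :
  h (t ++ x :: s ++ u) = (-1) ^+ size s *: h (t ++ s ++ x :: u).
Proof.
elim: s t => [|y s IHs] t /=; first by rewrite scale1r.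
rewrite halt -cat_rcons IHs cat_rcons exprS -scalerA scaleN1r; congr (- _).
Qed.

Lemma alt_dup t x s u : h (t ++ x :: s ++ x :: u) = 0.
Proof.
rewrite alt_move.
have: h ((t ++ s) ++ x :: x :: u) = 0.
  have /eqP := halt x x (t ++ s) u.
  rewrite -subr_eq0 opprK -mulr2n -scaler_nat scaler_eq0 pnatr_eq0 /=.
  by move/eqP.
by rewrite catA => ->; rewrite scaler0.
Qed.

Local Notation ltI := (fun j k : I => (j < k)%N).

Lemma ltI_trans : transitive ltI.
Proof. by move=> a b c; apply: ltn_trans. Qed.

Lemma enum_pairwise (S : {set I}) : pairwise ltI (enum S).
Proof.
rewrite -(sorted_pairwise ltI_trans).
have := iota_ltn_sorted 0 (\dim W).
rewrite -val_enum_ord sorted_map => H.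
apply: (subseq_sorted ltI_trans _ H).
by rewrite enumT; exact: filter_subseq.
Qed.

Lemma pairwise_split (s1 s2 : seq I) (i : I) :
  pairwise ltI s1 -> pairwise ltI s2 ->
  all (fun j : I => j < i)%N s1 -> all (fun j : I => i < j)%N s2 ->
  pairwise ltI (s1 ++ i :: s2).
Proof.
move=> p1 p2 /allP a1 /allP a2; rewrite pairwise_cat/= p1 p2 andbT /=.
apply/andP; split; last by apply/allP.
apply/allrelP => x y xs; rewrite inE => /orP[/eqP->|ys]; first exact: a1.
exact: ltn_trans (a1 _ xs) (a2 _ ys).
Qed.

Lemma enum_split (S T : {set I}) (i : I) : i \in T -> (T :\ i = S :\ i)%SET ->
  enum T = [seq j : I <- enum S | (j < i)%N] ++ i :: [seq j : I <- enum S | (i < j)%N].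
Proof.
move=> iT TS; apply: (irr_sorted_eq ltI_trans) => [x|||x].
- exact: ltnn.
- by rewrite (sorted_pairwise ltI_trans) enum_pairwise.
- rewrite (sorted_pairwise ltI_trans).
  by apply: pairwise_split; do ?[exact: filter_all];
    apply: pairwise_filter; exact: enum_pairwise.
- rewrite mem_cat inE (mem_filter (fun j : I => j < i)%N).
  rewrite (mem_filter (fun j : I => i < j)%N) !mem_enum.
  have := congr1 (fun U : {set I} => x \in U) TS; rewrite !inE.
  case: (ltngtP x i) => //= [xi|xi|/val_inj->]; last by rewrite eqxx iT.
    by rewrite -(inj_eq val_inj) /= (ltn_eqF xi) /= => ->; rewrite orbF.
  by rewrite -(inj_eq val_inj) /= (gtn_eqF xi) /= => ->.
Qed.

Lemma inversions1 (i : I) (S : {set I}) :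
  inversions [set i]%SET S = size [seq j : I <- enum S | (j < i)%N].
Proof.
have -> : size [seq j : I <- enum S | (j < i)%N] = #|[pred j in S | (j < i)%N]|.
  rewrite cardE /enum_mem -filter_predI; congr size; apply: eq_filter => j.
  by rewrite !inE andbC.
have pI : injective (fun j : I => (i, j)) by move=> j k [].
rewrite -(fintype.card_image pI); apply: eq_card => -[k j].
rewrite !inE /=; apply/idP/fintype.imageP => [/and3P[/eqP-> jS ji]|[l]].
  by exists j; rewrite // inE jS.
by rewrite inE => /andP[lS li] [-> ->]; rewrite eqxx lS.
Qed.

Lemma alt_vec t (i : I) (S : {set I}) :
  h (t ++ base i :: [seq base j | j <- enum S]) =
  if i \in S then 0 else (-1) ^+ inversions [set i]%SET S *:
    h (t ++ [seq base j | j <- enum (i |: S)%SET]).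
Proof.
have [iS|iS] := ifPn.
  by rewrite (enum_split iS erefl) map_cat /= alt_dup.
have SS : ((i |: S) :\ i = S :\ i)%SET.
  by apply/setP => j; rewrite !inE; case: eqP.
have iS' : (i \in i |: S)%SET by rewrite !inE eqxx.
rewrite (enum_split iS' SS).
have eS : enum S = [seq j : I <- enum S | (j < i)%N] ++ [seq j : I <- enum S | (i < j)%N].
  apply: (irr_sorted_eq ltI_trans) => [x|||x].
  - exact: ltnn.
  - by rewrite (sorted_pairwise ltI_trans) enum_pairwise.
  - rewrite (sorted_pairwise ltI_trans).
    rewrite pairwise_cat !(pairwise_filter _ (enum_pairwise S)) !andbT.
    apply/allrelP => a b; rewrite !mem_filter => /andP[ai _] /andP[ib _].
    exact: ltn_trans ai ib.
  - rewrite mem_cat (mem_filter (fun j : I => j < i)%N).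
    rewrite (mem_filter (fun j : I => i < j)%N) !mem_enum -andb_orl -neq_ltn.
    by case: eqVneq => // /val_inj ->; rewrite (negbTE iS).
rewrite {1}eS inversions1 !map_cat /= alt_move size_map.
by [].
Qed.

Lemma lin_ext_mon (k : seq V -> A) (S : {set I}) :
  lin_ext k (mon S) = k [seq base j | j <- enum S].
Proof.
rewrite /lin_ext (bigD1 S) //= ffunE eqxx scale1r big1 ?addr0// => T TS.
by rewrite ffunE (negbTE TS) scale0r.
Qed.

Lemma lin_extD (k : seq V -> A) (u v : Lam) :
  lin_ext k (u + v) = lin_ext k u + lin_ext k v.
Proof. by rewrite -big_split; apply: eq_bigr => S _; rewrite ffunE scalerDl. Qed.

Lemma lin_extZ (k : seq V -> A) (c : R) (v : Lam) :
  lin_ext k (c *: v) = c *: lin_ext k v.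
Proof. by rewrite scaler_sumr; apply: eq_bigr => S _; rewrite ffunE scalerA. Qed.

Lemma lin_ext_sum (k : seq V -> A) (J : finType) (P : pred J) (v : J -> Lam) :
  lin_ext k (\sum_(j | P j) v j) = \sum_(j | P j) lin_ext k (v j).
Proof.
apply: (big_morph _ (lin_extD k)).
by rewrite -(scale0r (0 : Lam)) lin_extZ scale0r.
Qed.

Lemma lin_ext_vec t x (v : Lam) : x \in W ->
  lin_ext (fun s => h (t ++ s)) (wedge (vec W x) v) =
  lin_ext (fun s => h (t ++ x :: s)) v.
Proof.
move=> xW; rewrite /wedge lin_ext_sum.
under eq_bigr => S _.
  rewrite lin_ext_sum.
  under eq_bigr => T _ do
    rewrite lin_extZ lin_ext_mon mulrCA -scalerA.
  rewrite -scaler_sumr [vec W x S]sum_ffunE.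
  under eq_bigr => i _ do rewrite !ffunE.
  rewrite scaler_suml.
  over.
rewrite exchange_big /= /lin_ext.
under [RHS]eq_bigr => T _.
  rewrite {1}(coord_vbasis xW) ml_sum scaler_sumr.
  under eq_bigr => i _ do rewrite alt_vec.
  over.
rewrite [RHS]exchange_big; apply: eq_bigr => i _ /=.
rewrite (bigD1 [set i]%SET)//= eqxx [X in _ + X]big1 ?addr0; last first.
  by move=> S /negbTE->; rewrite scaler0 scale0r.
rewrite [X in X *: _]mulr1 scaler_sumr [LHS]big_mkcond; apply: eq_bigr => T _.
rewrite disjoints1; case: (i \in T) => /=; first by rewrite !scaler0.
by rewrite !scalerA mulrA [in LHS]mulrC mulrA.
Qed.

End Ext.

Lemma lin_ext_wedges (A : lmodType R) (h : seq V -> A) (s : seq V) :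
  multilinear h -> alternating h -> {subset s <= W} ->
  lin_ext h (wedges W s) = h s.
Proof.
move=> hlin halt sW; rewrite -[RHS]/(h ([::] ++ s)) -[h in LHS]/(fun s => h ([::] ++ s)).
elim: s [::] sW => [|x s IHs] t sW; first by rewrite /wedges big_nil lin_ext_mon enum_set0.
rewrite /wedges big_cons (lin_ext_vec hlin halt); last by rewrite sW ?mem_head.
rewrite -cat_rcons -IHs; last by move=> y ys; rewrite sW ?inE ?ys ?orbT.
by apply: eq_bigr => S _; rewrite cat_rcons.
Qed.

End ExteriorFacts.

Section AntisymFacts.
Variables (R : realType) (V : vectType R) (A : lmodType R) (h : seq V -> A).

Lemma antisymE n (s : seq V) : size s = n ->
  antisym h s =
  \sum_(t : 'S_n) (-1) ^+ t *: h [seq s`_(t i) | i : 'I_n <- enum 'I_n].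
Proof. by move=> <-. Qed.

Lemma antisym_multilinear : multilinear h -> multilinear (antisym h).
Proof.
move=> hlin c x y s1 s2; set n := size (s1 ++ x :: s2).
have sz z : size (s1 ++ z :: s2) = n by rewrite /n !size_cat.
rewrite !(@antisymE n)// scaler_sumr -big_split; apply: eq_bigr => t _ /=.
have pn : (size s1 < n)%N by rewrite /n size_cat /= addnS ltnS leq_addr.
pose p := Ordinal pn; pose j := (t^-1)%g p.
have /splitPr jP : j \in enum 'I_n by rewrite mem_enum.
have := enum_uniq 'I_n; case: jP => B C.
rewrite cat_uniq /= negb_or => /and4P[_ /andP[jB _] jC _].
have nthp z : (s1 ++ z :: s2)`_(t j) = z by rewrite permKV nth_cat ltnn subnn.
have nthN z z' (D : seq 'I_n) : j \notin D ->
    [seq (s1 ++ z :: s2)`_(t i) | i <- D] =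
    [seq (s1 ++ z' :: s2)`_(t i) | i <- D].
  move=> jD; apply/eq_in_map => i iD; rewrite !nth_cat; case: ltnP => // si.
  case E : (t i - size s1)%N => //; suff: i = j by move=> ij; rewrite -ij iD in jD.
  apply: (@perm_inj _ t); rewrite permKV; apply: val_inj => /=.
  by apply/eqP; rewrite eqn_leq si andbT -subn_eq0 E.
rewrite !map_cat /= !nthp (nthN _ x B)// (nthN _ x C)// (nthN y x B)//.
by rewrite (nthN y x C)// hlin scalerDr !scalerA mulrC.
Qed.

Lemma antisym_alternating : alternating (antisym h).
Proof.
move=> x y s1 s2; set n := size (s1 ++ x :: y :: s2).
have sz : size (s1 ++ y :: x :: s2) = n by rewrite /n !size_cat.
rewrite !(@antisymE n)//.
have pn : (size s1 < n)%N by rewrite /n size_cat /= addnS ltnS leq_addr.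
have qn : ((size s1).+1 < n)%N by rewrite /n size_cat /= !addnS !ltnS leq_addr.
pose p := Ordinal pn; pose q := Ordinal qn.
have pq : p != q by rewrite -(inj_eq val_inj) /= neq_ltn ltnSn.
rewrite (reindex_inj (mulIg (tperm p q))) /= -sumrN; apply: eq_bigr => t _.
rewrite odd_permM odd_tperm pq signr_addb expr1 mulrN1 scaleNr.
congr (- (_ *: h _)); apply: eq_map => i; rewrite permM.
case: tpermP => [->|->|/eqP ip /eqP iq].
- by rewrite !nth_cat /= ltnn subnn ltnNge leqnSn /= subSnn.
- by rewrite !nth_cat /= ltnn subnn ltnNge leqnSn /= subSnn.
rewrite !nth_cat; case: ltnP => // si.
rewrite -(inj_eq val_inj) /= in ip; rewrite -(inj_eq val_inj) /= in iq.
case E : (t i - size s1)%N => [|[|//]].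
  by move: ip; rewrite eqn_leq si andbT -subn_eq0 E.
have := subnKC si; rewrite E addn1 => e; by rewrite -e eqxx in iq.
Qed.

End AntisymFacts.

Section Bernoulli.
Variable R : realType.

(* The first n coefficients b_k / k! of t / (e^t - 1), the inverse of the power
   series sum_k t^k / (k+1)!. *)
Fixpoint bern_seq (n : nat) : seq R :=
  if n is m.+1 then
    let s := bern_seq m in
    rcons s ((m == 0)%N%:R - \sum_(k < m) s`_k / ((m - k).+1)`!%:R)
  else [::].

Definition bernoulli (n : nat) : R := n`!%:R * (bern_seq n.+1)`_n.

Lemma size_bern_seq n : size (bern_seq n) = n.
Proof. by elim: n => //= n IHn; rewrite size_rcons IHn. Qed.

Lemma nth_bern_seq n k : (k < n)%N -> (bern_seq n)`_k = bernoulli k / k`!%:R.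
Proof.
move=> kn; rewrite /bernoulli mulrC mulKf ?pnatr_eq0 -?lt0n ?fact_gt0//.
elim: n kn => // n IHn; rewrite ltnS leq_eqVlt => /orP[/eqP -> //|kn].
by rewrite /= nth_rcons size_bern_seq kn IHn.
Qed.

Lemma bernoulli_gen n :
  \sum_(k < n.+1) bernoulli k / k`!%:R * (((n - k).+1)`!%:R)^-1 = (n == 0)%N%:R.
Proof.
rewrite big_ord_recr /= subnn factS fact0 muln1 invr1 mulr1.
rewrite -(nth_bern_seq (ltnSn n)) /= nth_rcons size_bern_seq ltnn eqxx.
rewrite addrC -[RHS]addr0 -addrA; congr (_ + _); apply/eqP.
rewrite addrC subr_eq0; apply/eqP; apply: eq_bigr => k _.
by rewrite nth_bern_seq.
Qed.

End Bernoulli.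

Section Operators.
Variables (R : realType) (g : vectType R) (L : lie_superalgebra g).
Variables (Ug : algType R) (iU : g -> Ug).

Definition gamma_form (s : seq g) : Ug :=
  ((size s)`!%:R)^-1 *: antisym (fun s' => \prod_(x <- s') iU x) s.

Definition gamma : Lambda R (part L true) -> Ug := lin_ext gamma_form.

Definition ads (a : g) (s : seq g) : g := foldr (br L) a s.

Definition theta_form (a : g) (s : seq g) : g :=
  if odd (size s) then
    let p := (size s).+1./2 in
    (bernoulli R (2 * p) * (2 ^+ (2 * p + 1) - 2) / ((2 * p)`!)%:R) *:
      antisym (ads a) s
  else 0.

Definition theta1 (a : g) : Lambda R (part L true) -> g := lin_ext (theta_form a).

Definition eps_form (a : g) (s : seq g) : g :=
  if odd (size s) then 0 else
    let p := (size s)./2 in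
    (bernoulli R (2 * p) * (- 2 ^+ (2 * p + 1) + 2 ^+ (2 * p) + 2)
       / ((2 * p)`!)%:R) *: antisym (ads a) s.

Definition epsilon (a : g) : Lambda R (part L true) -> g := lin_ext (eps_form a).

End Operators.

Arguments theta1 {R g} L a v.
Arguments epsilon {R g} L a v.

Section OperatorFacts.
Variables (R : realType) (g : vectType R) (L : lie_superalgebra g).
Variables (Ug : algType R) (iU : g -> Ug).

Lemma prod_multilinear :
  (forall (c : R) x y, iU (c *: x + y) = c *: iU x + iU y) ->
  multilinear (fun s => \prod_(x <- s) iU x).
Proof.
move=> iUl c x y s1 s2; rewrite !big_cat !big_cons iUl /=.
by rewrite mulrDl mulrDr -scalerAl -scalerAr.
Qed.

Lemma ads_multilinear a : multilinear (ads L a).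
Proof.
move=> c x y s1 s2; rewrite /ads !foldr_cat /= br_linl.
by elim: s1 => //= z s1 ->; rewrite br_linr.
Qed.

Lemma gamma_wedges s : (forall (c : R) x y, iU (c *: x + y) = c *: iU x + iU y) ->
  {subset s <= part L true} -> gamma iU (wedges (part L true) s) = gamma_form iU s.
Proof.
move=> iUl sL.
have hl := antisym_multilinear (prod_multilinear iUl).
apply: lin_ext_wedges => // [c x y s1 s2|x y s1 s2]; rewrite /gamma_form.
  by rewrite hl scalerDr !size_cat /= !scalerA mulrC.
by rewrite antisym_alternating scalerN !size_cat.
Qed.

Lemma theta1_wedges a s : {subset s <= part L true} ->
  theta1 L a (wedges (part L true) s) = theta_form L a s.
Proof.
move=> sL; have hl := antisym_multilinear (ads_multilinear a).
apply: lin_ext_wedges => // [c x y s1 s2|x y s1 s2]; rewrite /theta_form.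
  rewrite !size_cat /=; case: ifP => _; last by rewrite scaler0 addr0.
  by rewrite hl scalerDr !scalerA; congr (_ *: _ + _); rewrite [RHS]mulrC.
rewrite !size_cat /=; case: ifP => _; last by rewrite oppr0.
by rewrite antisym_alternating scalerN.
Qed.

Lemma epsilon_wedges a s : {subset s <= part L true} ->
  epsilon L a (wedges (part L true) s) = eps_form L a s.
Proof.
move=> sL; have hl := antisym_multilinear (ads_multilinear a).
apply: lin_ext_wedges => // [c x y s1 s2|x y s1 s2]; rewrite /eps_form.
  rewrite !size_cat /=; case: ifP => _; first by rewrite scaler0 addr0.
  by rewrite hl scalerDr !scalerA; congr (_ *: _ + _); rewrite [RHS]mulrC.
rewrite !size_cat /=; case: ifP => _; first by rewrite oppr0.
by rewrite antisym_alternating scalerN.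
Qed.

End OperatorFacts.

Section Sheaf.
Variables (R : realType) (n : nat) (G : lieGroupType R n) (g : vectType R).
Variable H : harish_chandra G g.
Variables (Ug : algType R) (iU : g -> Ug) (U : set G).

(* The component of parity p of Hom_{U(g_0)}(U(g), C^oo(U)). Linearity over
   U(g_0) is linearity over its generators b in g_0, and the component of U(g)
   of parity q is spanned by the products of homogeneous elements of g of total
   parity q. *)
Definition sheaf (p : bool) (F : {linear Ug -> (G -> R^o)}) : Prop :=
  [/\ forall u, Cinfty U (F u),
      forall b u x, b \in part H false -> U x ->
        F (iU b * u) x = phi0 H b (F u) x &
      forall s : seq (bool * g),
        all (fun y => y.2 \in part H y.1) s ->
        \big[addb/false]_(y <- s) y.1 != p -> F (\prod_(y <- s) iU y.2) = 0].

(* The component of parity p of Hom_R(Lambda(g_1), C^oo(U)). *)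
Definition hom_ext (p : bool)
    (f : {linear Lambda R (part H true) -> (G -> R^o)}) : Prop :=
  (forall v, Cinfty U (f v)) /\
  forall S : {set 'I_(\dim (part H true))}, odd #|S| != p -> f (mon S) = 0.

(* pF and pa are the parities of F and a. *)
Definition phihat (pF pa : bool) (a : g) (F : Ug -> (G -> R^o)) :
    Ug -> (G -> R^o) :=
  fun u x => (-1) ^+ (pF && pa) * F (iU (Ad H x^-1%g a) * u) x.

End Sheaf.

(* Main.v *)
Require Import Defs.
From HB Require Import structures.
From mathcomp Require Import all_boot all_order all_algebra monoid perm.
From mathcomp Require Import all_classical all_reals all_analysis.
From mathcomp Require Import ring.

Set Implicit Arguments.
Unset Strict Implicit.
Unset Printing Implicit Defensive.

Import Order.TTheory GRing.Theory Num.Theory.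
Import numFieldNormedType.Exports.

Local Open Scope classical_set_scope.
Local Open Scope ring_scope.

(** The statement is an identity in the enveloping algebra, evaluated by F:
    with b = Ad_{g^-1} a and v in the exterior algebra of the odd part,

      b gamma(v) = theta_1^b(v_(1)) gamma(v_(2)) + gamma(eps^b(v_(1)) /\ v_(2))

    (odd_mul_gamma).  Since theta_1^b takes values in the even part, linearity
    of F over the enveloping algebra of the even part turns the first summand
    into the action of phi_0; since theta_1^b vanishes on even elements, the
    sign (-1)^{|f||v_(1)|} of the convolution is the constant (-1)^{|f|} in
    the definition of the action of a.

    The identity is the super version of the formula for the differential of
    the exponential map.  Consider functions on words of odd elements with
    values in the enveloping algebra; under the signed shuffle product they
    form an associative algebra, in which the function xi sending a one-letter
    word to that letter plays the role of a generic element of the odd part,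
    with anticommuting parameters as coefficients.  Every ingredient becomes
    an expression in xi and b: gamma is the exponential of xi
    (gamma_formE), the antisymmetrised k-fold bracket is an element ad_k with
    ad_0 = b and ad_{k+1} = xi ad_k + ad_k xi (ad_powerS), convolution over
    the coproduct is the product (pairing_coprod), and eps^b(v_(1)) /\ v_(2)
    inserts ad_k at every position of a power of xi, with alternating signs
    (shuffle_gamma_eps).

    The recurrence for ad_k moves all powers of xi to the right, so in degree n
    both sides are combinations of the elements ad_r xi^{n-r}.  Comparing
    coefficients leaves one identity of power series in t,

      theta(t) + eps(t) (1 - e^{-t}) / t = 1,

    where theta(t) = tanh(t/2) and eps(t) = t / sinh t have the coefficients
    in the definitions of theta_1 and eps (coef_identity).  With
    B(t) = t / (e^t - 1), it follows from B(-t) = B(t) + t (bern_neg) and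
    (e^t - 1) B(2t) = 2 B(t) - 2 B(2t) (bern_double). *)

(** * Power series identities for the Bernoulli numbers *)

Section Coefficients.
Variable R : realType.
Implicit Types (p q w : {poly R}) (i j r k N : nat).

(** The coefficient of t^k in tanh(t/2). *)
Definition theta_coef k : R :=
  if odd k then
    let p := k.+1./2 in
    bernoulli R (2 * p) * (2 ^+ (2 * p + 1) - 2) / ((2 * p)`!)%:R
  else 0.

(** The coefficient of t^k in t / sinh t. *)
Definition eps_coef k : R :=
  if odd k then 0 else
    let p := k./2 in
    bernoulli R (2 * p) * (- 2 ^+ (2 * p + 1) + 2 ^+ (2 * p) + 2)
      / ((2 * p)`!)%:R.

(** Power series are represented by truncations, and identities between them by
    congruences modulo X^N with an explicit witness, so that they can be
    multiplied together by [ring]. *)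
Definition bern_egf N : {poly R} := \poly_(k < N) (bernoulli R k / k`!%:R).
(** Truncation of (e^t - 1) / t. *)
Definition expm1_egf N : {poly R} := \poly_(k < N) (k.+1`!%:R)^-1.
Definition exp_egf N : {poly R} := \poly_(k < N) (k`!%:R)^-1.

Lemma eq_of_eq_sub (V : zmodType) (x y u v : V) :
  u = v -> x - y = u - v -> x = y.
Proof. by move=> ->; rewrite subrr => /eqP; rewrite subr_eq0 => /eqP. Qed.

Lemma poly_congrP N p q :
  (forall i, (i < N)%N -> p`_i = q`_i) -> exists w : {poly R}, p = q + 'X^N * w.
Proof.
move=> pq; exists (drop_poly N (p - q)).
rewrite mulrC -[X in q + X]add0r -[X in q + (X + _)](_ : take_poly N (p - q) = 0).
  by rewrite poly_take_drop addrC subrK.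
apply/polyP => i; rewrite coef_take_poly coefB coef0.
by case: ltnP => // /pq ->; rewrite subrr.
Qed.

Lemma coef_congr N p q w i : p = q + 'X^N * w -> (i < N)%N -> p`_i = q`_i.
Proof. by move=> -> iN; rewrite coefD coefXnM iN addr0. Qed.

Lemma coef_scaleX p c i : (p \Po (c *: 'X))`_i = c ^+ i * p`_i.
Proof.
rewrite coef_comp_poly.
under eq_bigr => j _ do rewrite exprZn coefZ coefXn.
have [iN|Ni] := ltnP i (size p).
  rewrite (bigD1 (Ordinal iN)) //= eqxx mulr1 mulrC big1 ?addr0 // => j ji.
  by rewrite -(inj_eq val_inj) /= eq_sym in ji; rewrite (negbTE ji) !mulr0.
rewrite nth_default ?mulr0 // big1 // => j _.
by rewrite gtn_eqF ?mulr0 // (leq_trans (ltn_ord j)).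
Qed.

Lemma fact_neq0 n : n`!%:R != 0 :> R.
Proof. by rewrite pnatr_eq0 -lt0n fact_gt0. Qed.

(** e^{at} e^{bt} = e^{(a+b)t}; the cases (1, -1) and (1, 1) give the functional
    equations of (e^t - 1) / t under t -> -t and t -> 2t. *)
Lemma exp_egfD N (a b : R) : exists w : {poly R},
  (exp_egf N \Po (a *: 'X)) * (exp_egf N \Po (b *: 'X)) =
  (exp_egf N \Po ((a + b) *: 'X)) + 'X^N * w.
Proof.
apply: poly_congrP => i iN; rewrite coefM coef_scaleX coef_poly iN.
rewrite addrC exprDn mulr_suml; apply: eq_bigr => j _.
have ji : (j <= i)%N by rewrite -ltnS.
rewrite !coef_scaleX !coef_poly (leq_ltn_trans ji iN).
rewrite (leq_ltn_trans (leq_subr _ _) iN) -mulr_natr.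
have : 'C(i, j)%:R * (j`!%:R * (i - j)`!%:R) = i`!%:R :> R.
  by rewrite -!natrM bin_fact.
have := fact_neq0 j; have := fact_neq0 (i - j); have := fact_neq0 i.
move=> i0 ij0 j0 e; rewrite -e; field.
rewrite ij0 j0 -[X in X != 0](mulfK (mulf_neq0 j0 ij0)) e.
by rewrite mulf_neq0 ?invr_eq0 ?mulf_neq0.
Qed.

Lemma exp_egfS N (c : R) : exp_egf N.+1 \Po (c *: 'X) =
  1 + c *: ('X * (expm1_egf N \Po (c *: 'X))).
Proof.
apply/polyP => -[|i]; rewrite coef_scaleX coefD coefZ coefXM coef1 coef_poly /=.
  by rewrite expr0 fact0 invr1 mulr1 mulr0 addr0.
by rewrite coef_scaleX coef_poly ltnS add0r exprS mulrA.
Qed.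

Lemma bern_expm1 N : exists w : {poly R}, bern_egf N * expm1_egf N = 1 + 'X^N * w.
Proof.
apply: poly_congrP => i iN; rewrite coefM coef1 -(bernoulli_gen R).
apply: eq_bigr => j _; rewrite !coef_poly.
have ji : (j <= i)%N by rewrite -ltnS.
by rewrite (leq_ltn_trans ji iN) (leq_ltn_trans (leq_subr _ _) iN).
Qed.

Lemma bern_expm1_scale N (c : R) : exists w : {poly R},
  (bern_egf N \Po (c *: 'X)) * (expm1_egf N \Po (c *: 'X)) = 1 + 'X^N * w.
Proof.
have [w e] := bern_expm1 N; exists (c ^+ N *: (w \Po (c *: 'X))).
rewrite -rmorphM /= e rmorphD rmorph1 rmorphM /= rmorphXn /= comp_polyX.
by rewrite exprZn -scalerAl -scalerAr.
Qed.

Lemma mulX_congr N p q : (exists w : {poly R}, 'X * p = 'X * q + 'X^(N.+1) * w) ->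
  exists w : {poly R}, p = q + 'X^N * w.
Proof.
case=> w e; exists w; apply: (@mulfI _ 'X); first by rewrite polyX_eq0.
by rewrite e exprS mulrDr mulrA.
Qed.

Lemma comp_poly1X p : p \Po (1 *: 'X) = p.
Proof. by rewrite scale1r comp_polyXr. Qed.

Lemma comp_poly0X N : exp_egf N.+1 \Po (0 *: 'X) = 1.
Proof. by rewrite exp_egfS scale0r addr0. Qed.

(** B(-t) = B(t) + t: with E = (e^t - 1) / t = 1 / B, the relation
    e^t e^{-t} = 1 reads E(t) - E(-t) = t E(t) E(-t); multiply it by B(t) B(-t). *)
Lemma bern_neg N : exists w : {poly R},
  bern_egf N \Po ((-1) *: 'X) = bern_egf N + 'X + 'X^N * w.
Proof.
have [w1 e1] := bern_expm1 N; have [w2 e2] := bern_expm1_scale N (-1).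
have [w3 e3] : exists w : {poly R},
    expm1_egf N - (expm1_egf N \Po ((-1) *: 'X)) =
    'X * expm1_egf N * (expm1_egf N \Po ((-1) *: 'X)) + 'X^N * w.
  apply: mulX_congr; have [w] := exp_egfD N.+1 1 (-1).
  rewrite subrr comp_poly0X !exp_egfS comp_poly1X !scaleN1r scale1r => e.
  by exists w; apply: (eq_of_eq_sub e); ring.
move: (bern_egf N) (expm1_egf N) (bern_egf N \Po _) (expm1_egf N \Po _) e1 e2 e3
  => B E Bn En e1 e2 e3.
exists (Bn * B * w3 - w1 * Bn + w2 * B + 'X * (w1 + w2 + 'X^N * w1 * w2)).
have e : Bn * B * (E - En) = Bn * B * ('X * E * En + 'X^N * w3) by rewrite e3.
have e' : Bn * (B * E) - B * (Bn * En) =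
    'X * (B * E) * (Bn * En) + 'X^N * (Bn * B * w3).
  by transitivity (Bn * B * (E - En)); [|rewrite e]; ring.
by rewrite e1 e2 in e'; apply: (eq_of_eq_sub e'); ring.
Qed.

(** With E = (e^t - 1) / t = 1 / B, the relation e^{2t} = (e^t)^2 reads
    2 E(2t) = 2 E(t) + t E(t)^2; multiply it by B(t) B(2t). *)
Lemma bern_double N : exists w : {poly R},
  'X * (bern_egf N \Po (2 *: 'X)) * expm1_egf N =
  2 *: bern_egf N - 2 *: (bern_egf N \Po (2 *: 'X)) + 'X^N * w.
Proof.
have [w1 e1] := bern_expm1 N; have [w2 e2] := bern_expm1_scale N 2.
have [w e] := exp_egfD N.+1 1 1.
rewrite (_ : 1 + 1 = 2 :> R) // !exp_egfS comp_poly1X scale1r in e.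
move: (bern_egf N) (expm1_egf N) (bern_egf N \Po _) (expm1_egf N \Po _) e1 e2 e
  => B E B2 E2 e1 e2.
rewrite !scaler_nat => e.
have [w3 e3] : exists w : {poly R}, E *+ 2 + 'X * E * E = E2 *+ 2 + 'X^N * w.
  by apply: mulX_congr; exists w; apply: (eq_of_eq_sub e); ring.
exists (B2 * B * w3 - w1 * B2 *+ 2 + w2 * B *+ 2 - 'X * B2 * E * w1).
have {}e : B2 * B * (E *+ 2 + 'X * E * E) = B2 * B * (E2 *+ 2 + 'X^N * w3).
  by rewrite e3.
have e' : B2 * (B * E) *+ 2 + 'X * B2 * E * (B * E) =
    B * (B2 * E2) *+ 2 + 'X^N * (B2 * B * w3).
  by transitivity (B2 * B * (E *+ 2 + 'X * E * E)); [|rewrite e]; ring.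
by rewrite e1 e2 in e'; apply: (eq_of_eq_sub e'); ring.
Qed.

Local Notation beta k := (bernoulli R k / k`!%:R).

Lemma bernoulli_odd k : odd k -> k != 1%N -> beta k = 0.
Proof.
move=> ok k1; have [w] := bern_neg k.+1.
move/(fun e => coef_congr e (ltnSn k)).
rewrite coef_scaleX coefD coefX (negbTE k1) addr0 coef_poly ltnSn.
rewrite -signr_odd ok expr1 mulN1r => /eqP.
by rewrite -subr_eq0 -opprD oppr_eq0 -mulr2n mulrn_eq0 /= => /eqP.
Qed.

Lemma bernoulli_double r :
  \sum_(k < r.+1) 2 ^+ k * beta k / ((r - k).+1)`!%:R =
  2 * (1 - 2 ^+ r.+1) * beta r.+1.
Proof.
have [w] := bern_double r.+2.
move/(fun e => coef_congr e (ltnSn r.+1)).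
rewrite coefB !coefZ coef_scaleX coef_poly ltnSn -mulrA coefXM /= coefM.
move=> e; transitivity (2 * beta r.+1 - 2 * (2 ^+ r.+1 * beta r.+1)); last by ring.
rewrite -e; apply: eq_bigr => j _; rewrite coef_scaleX !coef_poly.
have jr : (j < r.+2)%N by apply: leq_trans (ltn_ord j) _.
by rewrite jr (leq_ltn_trans (leq_subr _ _)).
Qed.

(** On odd k the two formulas agree because b_k = 0 for k >= 3, while for k = 1
    the factor 2 - 2^k vanishes. *)
Lemma eps_coefE k : eps_coef k = beta k * (2 - 2 ^+ k).
Proof.
rewrite /eps_coef; case: ifPn => [ok|ek].
  have [->|k1] := eqVneq k 1%N; first by rewrite expr1 subrr mulr0.
  by rewrite bernoulli_odd ?mul0r.
have -> : (2 * k./2)%N = k by rewrite mul2n even_halfK.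
rewrite exprD expr1; ring.
Qed.

Lemma theta_coefE k : theta_coef k = (odd k)%:R * (beta k.+1 * (2 * 2 ^+ k.+1 - 2)).
Proof.
rewrite /theta_coef; case: ifPn => [ok|ek]; last by rewrite mul0r.
have -> : (2 * k.+1./2)%N = k.+1 by rewrite mul2n even_halfK //= ok.
rewrite mul1r exprD expr1; ring.
Qed.

Lemma bernoulli1 : beta 1 = - 2^-1.
Proof.
have e0 := bernoulli_gen R 0; rewrite big_ord1 subnn !factS fact0 in e0.
have := bernoulli_gen R 1; rewrite big_ord_recr big_ord1 /= !factS fact0 => e1.
have b0 : bernoulli R 0 = 1 by rewrite -[RHS]e0 /=; field.
by rewrite b0 in e1; apply: (eq_of_eq_sub e1); rewrite subn0; field.
Qed.

(** The coefficient of t^r in theta(t) + eps(t) (1 - e^{-t}) / t = 1.  As eps is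
    even, the sign (-1)^(r - k) is (-1)^r, so that the sum is the coefficient of
    (2 B(t) - B(2t)) (e^t - 1) / t up to this sign; bernoulli_double evaluates it. *)
Lemma coef_identity r :
  theta_coef r +
    \sum_(k < r.+1) eps_coef k * ((-1) ^+ (r - k) / ((r - k).+1)`!%:R) =
  (r == 0)%N%:R.
Proof.
have -> : \sum_(k < r.+1) eps_coef k * ((-1) ^+ (r - k) / ((r - k).+1)`!%:R) =
    (-1) ^+ r * (2 * (r == 0)%N%:R - 2 * (1 - 2 ^+ r.+1) * beta r.+1).
  rewrite -bernoulli_double -bernoulli_gen mulr_sumr -sumrB mulr_sumr.
  apply: eq_bigr => k _.
  have [ok|ek] := boolP (odd k).
    have : eps_coef k = 0 by rewrite /eps_coef ok.
    rewrite eps_coefE => e; rewrite e mul0r.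
    set c := beta k in e *; set d := _`!%:R.
    by transitivity ((-1) ^+ r * (c * (2 - 2 ^+ k) / d)); [rewrite e|]; ring.
  have kr : (k <= r)%N by rewrite -ltnS.
  have -> : (-1) ^+ (r - k) = (-1) ^+ r :> R.
    by rewrite -signr_odd oddB // (negbTE ek) addbF signr_odd.
  rewrite eps_coefE; ring.
rewrite theta_coefE; have [|er] := boolP (odd r).
  move=> ok; rewrite -signr_odd ok expr1 (_ : (r == 0)%N = false);
    last by case: (r) ok.
  by rewrite /=; ring.
rewrite -signr_odd (negbTE er) expr0 mul1r mul0r add0r.
case: r er => [|r] er; last by rewrite (@bernoulli_odd r.+2) // !mulr0 subr0.
by rewrite bernoulli1 /= expr1; field.
Qed.

End Coefficients.

(** * The algebra of functions on words under the signed shuffle product *)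

Section Shuffle.
Variables (R : realType) (T : Type) (A : lmodType R).
Implicit Types (K : seq T -> seq T -> A) (s u v : seq T).

(** The sum over all ways to split a word into two complementary subwords, with
    the sign of the corresponding unshuffle: a letter sent to the right subword
    passes all the letters that later go to the left one. *)
Fixpoint shuffle K s : A :=
  if s is x :: s' then
    shuffle (fun u v => K (x :: u) v) s' +
    shuffle (fun u v => (-1) ^+ size u *: K u (x :: v)) s'
  else K [::] [::].

Lemma eq_shuffle K K' s :
  (forall u v, size u + size v = size s -> K u v = K' u v)%N ->
  shuffle K s = shuffle K' s.
Proof.
elim: s K K' => [|x s IHs] K K' KK' /=; first exact: KK'.
by congr (_ + _); apply: IHs => u v uv; rewrite KK' //= ?addnS ?addSn uv.
Qed.

Lemma shuffle_linear K K' (c : R) s :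
  shuffle (fun u v => c *: K u v + K' u v) s = c *: shuffle K s + shuffle K' s.
Proof.
elim: s K K' => [|x s IHs] K K' //=.
rewrite IHs [X in _ + X = _](@eq_shuffle _ (fun u v =>
  c *: ((-1) ^+ size u *: K u (x :: v)) +
  (-1) ^+ size u *: K' u (x :: v))); last first.
  by move=> u v _; rewrite scalerDr !scalerA mulrC.
by rewrite IHs scalerDr addrACA.
Qed.

Lemma shuffle0 s : shuffle (fun _ _ => 0) s = 0.
Proof.
elim: s => //= x s IHs; rewrite IHs add0r -[RHS]IHs.
by apply: eq_shuffle => u v _; rewrite scaler0.
Qed.

Lemma shuffleZ K (c : R) s : shuffle (fun u v => c *: K u v) s = c *: shuffle K s.
Proof.
rewrite -[RHS]addr0 -(shuffle0 s) -shuffle_linear.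
by apply: eq_shuffle => u v _; rewrite addr0.
Qed.

Lemma shuffle_sum (I : Type) (r : seq I) (P : pred I)
    (K : I -> seq T -> seq T -> A) s :
  shuffle (fun u v => \sum_(i <- r | P i) K i u v) s =
  \sum_(i <- r | P i) shuffle (K i) s.
Proof.
elim: r => [|i r IHr].
  rewrite big_nil -[RHS](shuffle0 s).
  by apply: eq_shuffle => u v _; rewrite big_nil.
rewrite big_cons -IHr; case: ifP => Pi; last first.
  by apply: eq_shuffle => u v _; rewrite big_cons Pi.
rewrite -[X in X + _]scale1r -shuffle_linear.
by apply: eq_shuffle => u v _; rewrite big_cons Pi scale1r.
Qed.

Lemma shuffle_graded K s : shuffle K s =
  \sum_(k < (size s).+1) shuffle (fun u v => if size u == k then K u v else 0) s.
Proof.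
rewrite -shuffle_sum; apply: eq_shuffle => u v uv.
have us : (size u < (size s).+1)%N by rewrite ltnS -uv leq_addr.
rewrite (bigD1 (Ordinal us)) //= eqxx big1 ?addr0 // => k.
by rewrite -(inj_eq val_inj) /= eq_sym => /negbTE->.
Qed.

(** The sum over all letters of the word, with the sign of moving that letter to
    the front; this is the Laplace expansion along the first argument. *)
Fixpoint alt_sum (K : T -> seq T -> A) s : A :=
  if s is x :: s' then K x s' - alt_sum (fun y u => K y (x :: u)) s' else 0.

Lemma eq_alt_sum (K K' : T -> seq T -> A) s :
  (forall x u, (size u).+1 = size s -> K x u = K' x u) ->
  alt_sum K s = alt_sum K' s.
Proof.
elim: s K K' => //= x s IHs K K' KK'; congr (_ - _); first exact: KK'.
by apply: IHs => y u us; apply: KK'; rewrite /= us.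
Qed.

Lemma alt_sumD (K K' : T -> seq T -> A) s :
  alt_sum (fun x u => K x u + K' x u) s = alt_sum K s + alt_sum K' s.
Proof.
elim: s K K' => [|x s IHs] K K' /=; first by rewrite addr0.
by rewrite IHs opprD addrACA.
Qed.

Lemma alt_sumN (K : T -> seq T -> A) s :
  alt_sum (fun x u => - K x u) s = - alt_sum K s.
Proof.
elim: s K => [|x s IHs] K /=; first by rewrite oppr0.
by rewrite IHs opprD.
Qed.

End Shuffle.

Lemma shuffle_map (R : realType) (T T' : Type) (A : lmodType R) (e : T -> T')
    (K : seq T' -> seq T' -> A) s :
  shuffle K (map e s) = shuffle (fun u v => K (map e u) (map e v)) s.
Proof.
elim: s K => //= x s IHs K; rewrite !IHs; congr (_ + _).
by apply: eq_shuffle => u v _; rewrite size_map.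
Qed.

Lemma alt_sum_map (R : realType) (T T' : Type) (A : lmodType R) (e : T -> T')
    (K : T' -> seq T' -> A) s :
  alt_sum K (map e s) = alt_sum (fun x u => K (e x) (map e u)) s.
Proof. by elim: s K => //= x s IHs K; rewrite IHs. Qed.

(** An alias, since functions into a ring already carry the pointwise product. *)
Definition skew_fun (T : Type) (A : Type) : Type := seq T -> A.

HB.instance Definition _ (R : realType) (T : Type) (A : lmodType R) :=
  GRing.Lmodule.copy (skew_fun T A) (seq T -> A).

Section SkewAlgebra.
Variables (R : realType) (T : Type) (A : algType R).
Local Notation S := (skew_fun T A).
Implicit Types (P Q W : S) (s u v : seq T) (x : T) (c : R).

Definition conv P Q : S := shuffle (fun u v => P u * Q v).

(** The embedding of the coefficients as functions supported on the empty word. *)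
Definition at_nil (y : A) : S := fun s => if s is [::] then y else 0.

Definition shift x P : S := fun s => P (x :: s).

(** The k-th power of the parity automorphism. *)
Definition parity_twist k P : S := fun s => (-1) ^+ (k * size s) *: P s.

Lemma skew_addE P Q s : (P + Q) s = P s + Q s.
Proof. by []. Qed.

Lemma skew_scaleE c P s : (c *: P) s = c *: P s.
Proof. by []. Qed.

Lemma skew_sumE (I : Type) (r : seq I) (B : pred I) (P : I -> S) s :
  (\sum_(i <- r | B i) P i) s = \sum_(i <- r | B i) P i s.
Proof. by elim/big_rec2: _ => // i y Q _ <-. Qed.

(** Removing the first letter is a skew derivation; together with the value on
    the empty word this characterises the product, and all identities between
    products below follow by induction on the word. *)
Lemma conv_cons P Q x s : conv P Q (x :: s) =
  conv (shift x P) Q s + conv (parity_twist 1 P) (shift x Q) s.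
Proof.
congr (_ + _); apply: eq_shuffle => u v _.
by rewrite /parity_twist mul1n scalerAl.
Qed.

Lemma conv_linear_l c P P' Q : conv (c *: P + P') Q = c *: conv P Q + conv P' Q.
Proof.
apply/funext => s; rewrite -[RHS]/(c *: conv P Q s + conv P' Q s) -shuffle_linear.
by apply: eq_shuffle => u v _; rewrite -[(_ + _) u]/(c *: P u + P' u)
  mulrDl scalerAl.
Qed.

Lemma conv_linear_r c P Q Q' : conv P (c *: Q + Q') = c *: conv P Q + conv P Q'.
Proof.
apply/funext => s; rewrite -[RHS]/(c *: conv P Q s + conv P Q' s) -shuffle_linear.
by apply: eq_shuffle => u v _; rewrite -[(_ + _) v]/(c *: Q v + Q' v)
  mulrDr scalerAr.
Qed.

Lemma parity_twist_conv P Q :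
  parity_twist 1 (conv P Q) = conv (parity_twist 1 P) (parity_twist 1 Q).
Proof.
apply/funext => s; rewrite /parity_twist -[LHS]shuffleZ; apply: eq_shuffle => u v uv.
by rewrite !mul1n -uv exprD -scalerAl -scalerAr scalerA.
Qed.

Lemma convDl P P' Q : conv (P + P') Q = conv P Q + conv P' Q.
Proof. by have := conv_linear_l 1 P P' Q; rewrite !scale1r. Qed.

Lemma convDr P Q Q' : conv P (Q + Q') = conv P Q + conv P Q'.
Proof. by have := conv_linear_r 1 P Q Q'; rewrite !scale1r. Qed.

Lemma shift_conv x P Q : shift x (conv P Q) =
  conv (shift x P) Q + conv (parity_twist 1 P) (shift x Q).
Proof. by apply/funext => s; exact: conv_cons. Qed.

Lemma convA P Q W : conv P (conv Q W) = conv (conv P Q) W.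
Proof.
apply/funext => s; elim: s P Q W => [|x s IHs] P Q W; first exact: mulrA.
rewrite !conv_cons !shift_conv convDl convDr parity_twist_conv.
by rewrite !skew_addE !IHs addrA.
Qed.

Lemma conv0l P : conv 0 P = 0.
Proof.
apply/funext => s; rewrite -[RHS](shuffle0 A s).
by apply: eq_shuffle => u v _; rewrite mul0r.
Qed.

Lemma conv0r P : conv P 0 = 0.
Proof.
apply/funext => s; rewrite -[RHS](shuffle0 A s).
by apply: eq_shuffle => u v _; rewrite mulr0.
Qed.

Lemma shift_at_nil x y : shift x (at_nil y) = 0.
Proof. by []. Qed.

Lemma parity_twist_at_nil k y : parity_twist k (at_nil y) = at_nil y.
Proof.
apply/funext => -[|x s]; rewrite /parity_twist /= ?scaler0 //.
by rewrite muln0 scale1r.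
Qed.

Lemma conv_at_nil_l y P s : conv (at_nil y) P s = y * P s.
Proof.
elim: s P => [|x s IHs] P //.
by rewrite conv_cons shift_at_nil conv0l parity_twist_at_nil IHs /shift add0r.
Qed.

Lemma conv_at_nil_r y P s : conv P (at_nil y) s = P s * y.
Proof.
elim: s P => [|x s IHs] P //.
by rewrite conv_cons shift_at_nil conv0r IHs /shift addr0.
Qed.

Lemma conv1l : left_id (at_nil 1) conv.
Proof. by move=> P; apply/funext => s; rewrite conv_at_nil_l mul1r. Qed.

Lemma conv1r : right_id (at_nil 1) conv.
Proof. by move=> P; apply/funext => s; rewrite conv_at_nil_r mulr1. Qed.

Lemma at_nil1_neq0 : at_nil 1 != 0.
Proof.
apply/eqP => /(congr1 (fun P : S => P [::])) /eqP.
by rewrite (negbTE (oner_neq0 A)).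
Qed.

HB.instance Definition _ := GRing.Zmodule_isNzRing.Build S
  convA conv1l conv1r convDl convDr at_nil1_neq0.

Lemma conv_scaleAl c P Q : c *: (P * Q) = (c *: P) * Q.
Proof.
by have := conv_linear_l c P 0 Q; rewrite addr0 [conv 0 Q]conv0l addr0 => <-.
Qed.

Lemma conv_scaleAr c P Q : c *: (P * Q) = P * (c *: Q).
Proof.
by have := conv_linear_r c P Q 0; rewrite addr0 [conv P 0]conv0r addr0 => <-.
Qed.

HB.instance Definition _ := GRing.Lmodule_isLalgebra.Build R S conv_scaleAl.
HB.instance Definition _ := GRing.Lalgebra_isAlgebra.Build R S conv_scaleAr.

End SkewAlgebra.

(** * Powers of the generic odd element and the coefficient identity *)

Section Letters.
Variables (R : realType) (T : Type) (A : algType R) (e : T -> A).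
Local Notation S := (skew_fun T A).
Local Notation const := (@at_nil R T A).
Implicit Types (P Q : S) (s u v : seq T) (x y : T) (i j k l m : nat).

Definition letter : S := fun s => if s is [:: x] then e x else 0.

Lemma shift_letter x : shift x letter = const (e x).
Proof. by apply/funext => -[]. Qed.

Lemma parity_twist_letter : parity_twist 1 letter = - letter.
Proof.
apply/funext => s; rewrite /parity_twist mul1n -[RHS]/(- letter s).
by case: s => [|x [|y s]] /=; rewrite ?scaler0 ?oppr0 // expr1 scaleN1r.
Qed.

Lemma skew_oppE P s : (- P) s = - P s.
Proof. by []. Qed.

Lemma skew_mulE P Q s : (P * Q) s = shuffle (fun u v => P u * Q v) s.
Proof. by []. Qed.

Lemma mul_cons P Q x s : (P * Q) (x :: s) =
  (shift x P * Q) s + (parity_twist 1 P * shift x Q) s.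
Proof. exact: conv_cons. Qed.

Lemma shift_mul x P Q :
  shift x (P * Q) = shift x P * Q + parity_twist 1 P * shift x Q.
Proof. exact: shift_conv. Qed.

Lemma mul_at_nil_l (c : A) P s : (const c * P) s = c * P s.
Proof. exact: conv_at_nil_l. Qed.

Lemma mul_at_nil_r (c : A) P s : (P * const c) s = P s * c.
Proof. exact: conv_at_nil_r. Qed.

Lemma mul_letter_l Q s :
  (letter * Q) s = alt_sum (fun x u => e x * Q u) s.
Proof.
elim: s Q => [|x s IHs] Q; first exact: mul0r.
rewrite mul_cons shift_letter mul_at_nil_l parity_twist_letter mulNr skew_oppE.
by rewrite IHs.
Qed.

Lemma mul_letter_r Q s :
  (Q * letter) s = alt_sum (fun x u => (-1) ^+ size u *: (Q u * e x)) s.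
Proof.
elim: s Q => [|x s IHs] Q; first exact: mulr0.
rewrite mul_cons shift_letter mul_at_nil_r IHs addrC /parity_twist mul1n -scalerAl.
congr (_ + _); rewrite -alt_sumN; apply: eq_alt_sum => y u _.
by rewrite exprS mulN1r scaleNr opprK.
Qed.

(** The skew Leibniz rule: differentiating a power in the direction y inserts y at
    each position.  The sign comes from the powers of the odd letter in front. *)
Lemma shift_letterX y l : shift y (letter ^+ l.+1) =
  \sum_(i < l.+1) (-1) ^+ i *: (letter ^+ i * (const (e y) * letter ^+ (l - i))).
Proof.
elim: l => [|l IHl].
  by rewrite big_ord1 subnn !expr0 expr1 scale1r mulr1 mul1r shift_letter.
rewrite exprS shift_mul shift_letter parity_twist_letter IHl.
rewrite [RHS]big_ord_recl /= subn0 !expr0 scale1r mul1r; congr (_ + _).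
rewrite mulr_sumr.
apply: eq_bigr => i _; rewrite /bump /= add1n subSS !exprS mulN1r scaleNr.
by rewrite -scalerAr mulNr scalerN !mulrA.
Qed.

Lemma shift_parity_twist x k P :
  shift x (parity_twist k P) = (-1) ^+ k *: parity_twist k (shift x P).
Proof.
apply/funext => s; rewrite skew_scaleE /shift /parity_twist /= mulnS exprD.
by rewrite scalerA.
Qed.

Lemma parity_twistD j k P :
  parity_twist j (parity_twist k P) = parity_twist (j + k) P.
Proof.
by apply/funext => s; rewrite /parity_twist scalerA -exprD -mulnDl.
Qed.

(** A coefficient that depends on the left subword can be replaced by the function
    it defines.  In the product P Y Q the letters used by Y come after those used
    by P, which accounts for the twist of P by the length of the left subword. *)
Lemma shuffle_insert P (Y : S) Q s :
  shuffle (fun u v =>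
    (parity_twist (size u) P * (const (Y u) * Q) : S) v) s =
  (P * (Y * Q)) s.
Proof.
elim: s P Y Q => [|x s IHs] P Y Q.
  by rewrite /= [LHS]/(_ * _) /parity_twist /= scale1r.
rewrite mul_cons shift_mul mulrDr skew_addE.
rewrite -!IHs /= addrCA; congr (_ + _).
  by apply: eq_shuffle => u v _; rewrite parity_twistD addn1.
rewrite -[X in X + _]scale1r -shuffle_linear; apply: eq_shuffle => u v _.
rewrite mul_cons shift_parity_twist shift_mul.
rewrite shift_at_nil mul0r add0r parity_twist_at_nil !parity_twistD.
rewrite -!scalerAl skew_scaleE scale1r scalerDr scalerA -exprD.
rewrite addnn -signr_odd odd_double scale1r addnC; congr (_ + _).
have -> : const (parity_twist 1 Y u) = (-1) ^+ size u *: const (Y u).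
  by apply/funext => -[|y w]; rewrite skew_scaleE /= ?scaler0 // /parity_twist mul1n.
by rewrite -scalerAl -scalerAr.
Qed.

End Letters.

Section CommutatorPowers.
Variables (R : realType) (A : algType R) (x : A) (a : nat -> A).
Hypothesis aS : forall k, a k.+1 = x * a k + a k * x.

(** Alternating sums of insertions in normal form: moving x to the right past a_k
    raises k by one, and Pascal's rule collects the terms.  Formally this is the
    expansion of (R^(m+1) - (R - D)^(m+1)) / D in powers of D, where R is right
    multiplication by x and D = x _ + _ x, so that -(x _) = R - D. *)
Lemma alt_insert_ad k m :
  \sum_(i < m.+1) (-1) ^+ i *: (x ^+ i * (a k * x ^+ (m - i))) =
  \sum_(j < m.+1) ((-1) ^+ j * 'C(m.+1, j.+1)%:R) *: (a (k + j)%N * x ^+ (m - j)).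
Proof.
elim: m => [|m IHm].
  by rewrite !big_ord1 subnn addn0 !expr0 binn !mul1r.
rewrite big_ord_recl /= subn0 !expr0 scale1r mul1r.
have -> : \sum_(i < m.+1) (-1) ^+ bump 0 i *:
      (x ^+ bump 0 i * (a k * x ^+ (m.+1 - bump 0 i))) =
    - (x * \sum_(i < m.+1) (-1) ^+ i *: (x ^+ i * (a k * x ^+ (m - i)))).
  rewrite mulr_sumr -sumrN; apply: eq_bigr => i _.
  by rewrite /bump /= add1n subSS !exprS mulN1r scaleNr -scalerAr !mulrA.
pose c j : R := (-1) ^+ j * 'C(m.+1, j.+1)%:R.
pose f j := a (k + j)%N * x ^+ (m.+1 - j).
have -> : x * \sum_(i < m.+1) (-1) ^+ i *: (x ^+ i * (a k * x ^+ (m - i))) =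
    \sum_(j < m.+1) c j *: f j.+1 - \sum_(j < m.+1) c j *: f j.
  rewrite IHm mulr_sumr -sumrB; apply: eq_bigr => j _.
  have xa : x * a (k + j)%N = a (k + j.+1)%N - a (k + j)%N * x.
    by rewrite addnS aS addrK.
  rewrite -scalerAr mulrA xa mulrBl -mulrA -exprS -subSn; last by rewrite -ltnS.
  by rewrite scalerBr.
have -> : a k * x ^+ m.+1 = f 0%N by rewrite /f addn0 subn0.
rewrite opprB addrA.
rewrite -[RHS]/(\sum_(j < m.+2) ((-1) ^+ j * 'C(m.+2, j.+1)%:R) *: f j).
have -> : \sum_(j < m.+2) ((-1) ^+ j * 'C(m.+2, j.+1)%:R) *: f j =
   \sum_(j < m.+2) ((-1) ^+ j * 'C(m.+1, j.+1)%:R) *: f j +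
   \sum_(j < m.+2) ((-1) ^+ j * 'C(m.+1, j)%:R) *: f j.
  rewrite -big_split; apply: eq_bigr => j _ /=.
  by rewrite -scalerDl -mulrDr -natrD -binS.
rewrite [X in _ = X + _]big_ord_recr /= bin_small // mulr0 scale0r addr0.
rewrite [X in _ = _ + X]big_ord_recl /= expr0 bin0 mulr1 scale1r.
rewrite addrAC [LHS]addrC -sumrN; congr (_ + (_ + _)); apply: eq_bigr => j _.
by rewrite exprS mulN1r mulNr scaleNr.
Qed.

Lemma sum_triangle (F : nat -> nat -> A) n :
  \sum_(k < n.+1) \sum_(j < (n - k).+1) F k (k + j)%N =
  \sum_(r < n.+1) \sum_(k < r.+1) F k r.
Proof.
transitivity (\sum_(k < n.+1) \sum_(r < n.+1 | (k <= r)%N) F k r).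
  apply: eq_bigr => k _; transitivity (\sum_(k <= r < n.+1) F k r).
    rewrite -[X in \sum_(X <= _ < _) _]add0n big_addn subSn; last by rewrite -ltnS.
    by rewrite big_mkord; apply: eq_bigr => j _; rewrite addnC.
  by rewrite (big_nat_widenl k 0%N) //= big_mkord.
rewrite (exchange_big_dep xpredT) //=; apply: eq_bigr => r _.
by rewrite [RHS](big_ord_widen n.+1 (F^~ r)).
Qed.

(** After alt_insert_ad the coefficient of a_r x^(n - r) on the left is
    coef_identity divided by (n - r)!. *)
Lemma tanh_sinh_identity n :
  \sum_(k < n.+1) (theta_coef R k / (n - k)`!%:R) *: (a k * x ^+ (n - k)) +
  \sum_(k < n.+1) (eps_coef R k / ((n - k).+1)`!%:R) *:
    (\sum_(i < (n - k).+1) (-1) ^+ i *: (x ^+ i * (a k * x ^+ (n - k - i)))) =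
  (n`!%:R)^-1 *: (a 0 * x ^+ n).
Proof.
pose F k r := (eps_coef R k * ((-1) ^+ (r - k) / ((r - k).+1)`!%:R) / (n - r)`!%:R)
  *: (a r * x ^+ (n - r)).
(* The index r = k + j is the total degree in the commutators. *)
rewrite (_ : \sum_(k < n.+1) (eps_coef R k / _) *: _ =
    \sum_(k < n.+1) \sum_(j < (n - k).+1) F k (k + j)%N); last first.
  apply: eq_bigr => k _; rewrite alt_insert_ad scaler_sumr.
  apply: eq_bigr => j _; rewrite /F scalerA addKn subnDA; congr (_ *: _).
  have jn : (j.+1 <= (n - k).+1)%N by [].
  have := bin_fact jn; rewrite subSS.
  have := fact_neq0 R (n - k).+1; have := fact_neq0 R j.+1.
  have := fact_neq0 R (n - k - j).
  move: (n - k).+1`! j.+1`! (n - k - j)`! 'C(_, _) => d p q b q0 p0 d0 bpq.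
  have {bpq} -> : b%:R = d%:R / (p%:R * q%:R) :> R.
    by rewrite -bpq !natrM mulfK ?mulf_neq0.
  by field; rewrite d0 p0 q0.
rewrite sum_triangle -big_split /= {}/F.
rewrite (eq_bigr (fun r : 'I_n.+1 =>
  ((r == 0 :> nat)%:R / (n - r)`!%:R) *: (a r * x ^+ (n - r)))); last first.
  move=> r _; rewrite -scaler_suml -scalerDl -coef_identity mulrDl mulr_suml.
  by [].
rewrite big_ord_recl /= mul1r subn0 big1 ?addr0 // => i _.
by rewrite mul0r scale0r.
Qed.

End CommutatorPowers.

(** * Antisymmetrisation and the iterated commutators *)

Section AntisymExpansion.
Variables (R : realType) (V : vectType R) (A : lmodType R).
Implicit Types (h : seq V -> A) (s u : seq V).

Lemma alt_sumE (K : V -> seq V -> A) s : alt_sum K s =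
  \sum_(j < size s) (-1) ^+ j *: K s`_j (take j s ++ drop j.+1 s).
Proof.
elim: s K => [|x s IHs] K; first by rewrite big_ord0.
rewrite /= IHs big_ord_recl /= drop0 expr0 scale1r; congr (_ + _).
rewrite -sumrN; apply: eq_bigr => j _.
by rewrite /bump /= add1n exprS mulN1r scaleNr.
Qed.

Lemma nth_remove (s : seq V) m (j : 'I_m.+1) (k : 'I_m) : size s = m.+1 ->
  (take j s ++ drop j.+1 s)`_k = s`_(lift j k).
Proof.
move=> sm; rewrite nth_cat size_takel ?sm; last by rewrite ltnW.
have [kj|jk] := ltnP k j; first by rewrite nth_take //= /bump leqNgt kj.
by rewrite nth_drop /= /bump jk addSn subnKC.
Qed.

(** A permutation is determined by the image of 0 and by what it does to the
    rest; this gives the Laplace expansion of an antisymmetrisation. *)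
Lemma lift_perm_bij m :
  bijective (fun p : 'I_m.+1 * 'S_m => lift_perm ord0 p.1 p.2).
Proof.
apply: inj_card_bij; last by rewrite card_prod card_ord !card_Sn factS.
move=> [i s] [j t] /= e.
have ij : i = j by rewrite -(lift_perm_id ord0 i s) e lift_perm_id.
rewrite ij in e *; congr (_, _); apply/permP => k; apply: (@lift_inj _ j).
by rewrite -!(lift_perm_lift ord0) e.
Qed.

Lemma antisym_alt_sum h s : s != [::] ->
  antisym h s = alt_sum (fun x u => antisym (fun w => h (x :: w)) u) s.
Proof.
move=> s0; have [m sm] : exists m, size s = m.+1.
  by case: s s0 => // x u _; exists (size u).
rewrite (antisymE _ sm) (reindex _ (onW_bij _ (lift_perm_bij m))) /=.
rewrite -(pair_bigA _ (fun j t => (-1) ^+ lift_perm ord0 j t *: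
  h [seq s`_(lift_perm ord0 j t i) | i <- enum 'I_m.+1])) /= alt_sumE sm.
apply: eq_bigr => j _; set u := take j s ++ drop j.+1 s.
have um : size u = m.
  rewrite size_cat size_drop size_takel sm; last by rewrite ltnW.
  by rewrite subSS subnKC // -ltnS.
rewrite (antisymE _ um) scaler_sumr; apply: eq_bigr => t _.
rewrite odd_lift_perm /= signr_addb signr_odd scalerA.
rewrite enum_ordSl /= lift_perm_id -map_comp; congr (_ *: h (_ :: _)).
by apply: eq_map => i /=; rewrite lift_perm_lift (nth_remove _ _ sm).
Qed.

Lemma antisym_nil h : antisym h [::] = h [::].
Proof.
rewrite (@antisymE _ _ _ _ 0) // (big_pred1 (1%g : 'S_0)); last first.
  by move=> t; apply/esym/eqP/permP => -[].
by rewrite odd_perm1 expr0 scale1r enum_ord0.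
Qed.

End AntisymExpansion.

Section LinearImage.
Variables (R : realType) (V : vectType R) (A B : lmodType R) (f : A -> B).
Hypothesis f_lin : forall (c : R) x y, f (c *: x + y) = c *: f x + f y.

Lemma lin_fun0 : f 0 = 0.
Proof. by have := f_lin 1 0 0; rewrite !scale1r addr0 -[LHS]addr0 => /addrI. Qed.

Lemma lin_funZ c x : f (c *: x) = c *: f x.
Proof. by have := f_lin c x 0; rewrite lin_fun0 !addr0. Qed.

Lemma lin_fun_sum (I : Type) (r : seq I) (P : pred I) (c : I -> R) (x : I -> A) :
  f (\sum_(i <- r | P i) c i *: x i) = \sum_(i <- r | P i) c i *: f (x i).
Proof.
elim: r => [|i r IHr]; first by rewrite !big_nil lin_fun0.
by rewrite !big_cons; case: ifP => // _; rewrite f_lin IHr.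
Qed.

Lemma lin_fun_antisym (h : seq V -> A) s :
  f (antisym h s) = antisym (fun u => f (h u)) s.
Proof. exact: lin_fun_sum. Qed.

End LinearImage.

Lemma eq_antisym (R : realType) (V : vectType R) (A : lmodType R)
    (h h' : seq V -> A) s :
  (forall u, size u = size s -> h u = h' u) -> antisym h s = antisym h' s.
Proof.
by move=> hh'; apply: eq_bigr => t _; rewrite hh' // size_map -cardE card_ord.
Qed.

Section OddLetters.
Variables (R : realType) (g : vectType R) (L : lie_superalgebra g).
Variables (Ug : algType R) (iU : g -> Ug).
Hypothesis iU_rep : super_rep L iU.
Local Notation odd_g := (part L true).
Local Notation T := (subvs_of odd_g).
Local Notation S := (skew_fun T Ug).
Local Notation emb := (map (vsval : T -> g)).

Let iU_lin : forall (c : R) x y, iU (c *: x + y) = c *: iU x + iU y :=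
  iU_rep.1.

(** The generic odd element.  The letters are taken in the odd part as a type of
    its own, so that identities between functions on words need no parity
    hypothesis. *)
Definition odd_letter : S := letter (fun x : T => iU (vsval x)).

(** The antisymmetrised product of n letters is the n-th power of the generic odd
    element: both satisfy the same expansion along the first factor. *)
Lemma antisym_prod (s : seq T) :
  antisym (fun u => \prod_(x <- u) iU x) (emb s) = (odd_letter ^+ size s) s.
Proof.
have [m] := ubnP (size s); elim: m s => // m IHm [|x s] sm.
  by rewrite antisym_nil big_nil.
rewrite antisym_alt_sum // alt_sum_map [size _]/= exprS mul_letter_l.
apply: eq_alt_sum => y u /= [us]; rewrite -us -IHm ?us //.
rewrite (lin_fun_antisym (f := fun z => iU (vsval y) * z)); last first.
  by move=> c z w; rewrite mulrDr -scalerAr.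
by apply: eq_antisym => w _; rewrite big_cons.
Qed.

(** Each bracket with an odd element changes the parity. *)
Lemma antisym_ads_part a s : a \in odd_g -> {subset s <= odd_g} ->
  antisym (ads L a) s \in part L (~~ odd (size s)).
Proof.
move=> ao so; apply: memv_suml => t _; apply: memvZ.
have: {subset [seq s`_(t i) | i <- enum 'I_(size s)] <= odd_g}.
  by move=> x /mapP[i _ ->]; apply/so/mem_nth.
have: size [seq s`_(t i) | i <- enum 'I_(size s)] = size s.
  by rewrite size_map -cardE card_ord.
move: (map _ _) => u <-; elim: u => [|x u IHu] uo //=.
have := @br_part _ _ L true (~~ odd (size u)) x (ads L a u).
rewrite addTb; apply; first by apply: uo; rewrite mem_head.
by apply: IHu => y yu; apply: uo; rewrite in_cons yu orbT.
Qed.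

Variables (a : g) (a_odd : a \in odd_g).

(** The degree k part of the antisymmetrised iterated bracket applied to a. *)
Definition ad_power k : S := fun s =>
  if size s == k then iU (antisym (ads L a) (emb s)) else 0.

Lemma ad_powerE s : ad_power (size s) s = iU (antisym (ads L a) (emb s)).
Proof. by rewrite /ad_power eqxx. Qed.

Lemma ad_power_neq k s : size s != k -> ad_power k s = 0.
Proof. by rewrite /ad_power => /negbTE->. Qed.

Lemma emb_odd (s : seq T) : {subset emb s <= odd_g}.
Proof. by move=> x /mapP[y _ ->]; exact: subvsP. Qed.

Lemma ad_power0 : ad_power 0 = at_nil (iU a).
Proof. by apply/funext => -[|x s] //; rewrite /ad_power /= antisym_nil. Qed.

(** When y is an iterated bracket of k letters with an odd element, its parity is
    opposite to that of k, and the commutator sign is a plus times (-1)^k. *)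
Lemma iU_bracket_odd k (x y : g) : x \in odd_g -> y \in part L (~~ odd k) ->
  iU (br L x y) = iU x * iU y + (-1) ^+ k *: (iU y * iU x).
Proof.
move=> xo yk; rewrite -(iU_rep.2 _ _ _ _ xo yk) /=; congr (_ + _).
by rewrite -scaleNr signrN opprK signr_odd.
Qed.

(** A letter appended on the right of a word of length k costs (-1)^k when it is
    moved to the front.  This sign cancels the one of the super bracket, so the
    bracket becomes an anticommutator. *)
Lemma ad_powerS k :
  ad_power k.+1 = odd_letter * ad_power k + ad_power k * odd_letter.
Proof.
apply/funext => s; rewrite skew_addE mul_letter_l mul_letter_r -alt_sumD.
have [sk|sk] := eqVneq (size s) k.+1; last first.
  rewrite ad_power_neq //; transitivity (alt_sum (fun _ _ => 0 : Ug) s).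
    by elim: s {sk} => //= x s IHs; rewrite -IHs subrr.
  apply: eq_alt_sum => x u us; have uk : size u != k by rewrite -eqSS us.
  by rewrite ad_power_neq // mulr0 mul0r scaler0 addr0.
rewrite -sk ad_powerE (lin_fun_antisym iU_lin) antisym_alt_sum; last first.
  by case: s sk.
rewrite alt_sum_map; apply: eq_alt_sum => x u us.
have uk : size u = k by case: (etrans us sk).
rewrite -uk ad_powerE -(lin_fun_antisym iU_lin) /=.
rewrite -(lin_fun_antisym (br_linr L (vsval x))).
apply: iU_bracket_odd; first exact: subvsP.
by have := antisym_ads_part a_odd (@emb_odd u); rewrite size_map.
Qed.

End OddLetters.

(** * Pairing the coproduct with alternating forms *)

Section Pairing.
Variables (R : realType) (V : vectType R) (W : {vspace V}) (A : lmodType R).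
Local Notation I := 'I_(\dim W).
Local Notation Lam := (Lambda R W).
Local Notation Lam2 := (Lambda2 R W).
Local Notation mn := (@mon R V W).
Implicit Types (K : seq V -> seq V -> A) (X Y : {set I}) (Z : Lam2) (v w : Lam).

Definition basis_seq X : seq V := [seq (vbasis W)`_i | i : I <- enum X].

(** Sums over the coproduct, with the components of a tensor recorded on pairs of
    basis monomials. *)
Definition pairing K Z : A :=
  \sum_(p : {set I} * {set I}) Z p *: K (basis_seq p.1) (basis_seq p.2).

Definition alternating_form (h : seq V -> A) : Prop :=
  Defs.multilinear h /\ Defs.alternating h.

Definition alternating_biform K : Prop :=
  (forall t, alternating_form (K^~ t)) /\ (forall s, alternating_form (K s)).

Lemma pairing_linear K (c : R) Z Z' :
  pairing K (c *: Z + Z') = c *: pairing K Z + pairing K Z'.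
Proof.
rewrite scaler_sumr -big_split; apply: eq_bigr => p _.
by rewrite !ffunE scalerDl scalerA.
Qed.

Lemma pairing_tens K v w : pairing K (tens v w) =
  \sum_X \sum_Y (v X * w Y) *: K (basis_seq X) (basis_seq Y).
Proof. by rewrite pair_bigA; apply: eq_bigr => p _; rewrite ffunE. Qed.

Lemma mon_sum (B : lmodType R) X (F : {set I} -> B) :
  \sum_Y mn X Y *: F Y = F X.
Proof.
rewrite (bigD1 X) //= ffunE eqxx scale1r big1 ?addr0 // => Y YX.
by rewrite ffunE (negbTE YX) scale0r.
Qed.

Lemma pairing_tens_monr K v Y :
  pairing K (tens v (mn Y)) = lin_ext (K^~ (basis_seq Y)) v.
Proof.
rewrite pairing_tens; apply: eq_bigr => X _.
under eq_bigr => T _ do rewrite -scalerA.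
by rewrite -scaler_sumr mon_sum.
Qed.

Lemma pairing_tens_monl K w X :
  pairing K (tens (mn X) w) = lin_ext (K (basis_seq X)) w.
Proof.
rewrite pairing_tens exchange_big; apply: eq_bigr => Y _ /=.
under eq_bigr => T _ do rewrite mulrC -scalerA.
by rewrite -scaler_sumr mon_sum.
Qed.

Lemma wedge_suml v w : wedge v w = \sum_X v X *: wedge (mn X) w.
Proof.
apply: eq_bigr => X _; rewrite {1}/wedge.
under [in RHS]eq_bigr => Y _.
  under eq_bigr => T _ do rewrite mulrCA -scalerA.
  rewrite -scaler_sumr.
  over.
rewrite mon_sum scaler_sumr; apply: eq_bigr => Y _.
by rewrite scalerA mulrCA.
Qed.

Lemma wedge1l w : wedge (lam1 W) w = w.
Proof.
rewrite /wedge.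
under eq_bigr => Y _.
  under eq_bigr => T _ do rewrite mulrCA -scalerA.
  rewrite -scaler_sumr.
  over.
rewrite mon_sum; apply/ffunP => X.
rewrite sum_ffunE (bigD1 X) /=; last by rewrite -setI_eq0 finset.set0I.
rewrite finset.set0U !ffunE eqxx.
have -> : inversions finset.set0 X = 0.
  by apply: eq_card0 => p; rewrite !inE.
rewrite expr0 mul1r [_ *: _]mulr1 big1 ?addr0 // => Y /andP[_ YX].
by rewrite finset.set0U !ffunE eq_sym (negbTE YX) scaler0.
Qed.

Lemma pairing_tmul K Z Z' : pairing K (tmul Z Z') =
  \sum_(q : {set I} * {set I}) Z' q *:
    \sum_(p : {set I} * {set I}) ((-1) ^+ (#|p.2| * #|q.1|) * Z p) *:
    pairing K (tens (wedge (mn p.1) (mn q.1))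
                    (wedge (mn p.2) (mn q.2))).
Proof.
have pairing_sum (J : finType) (c : J -> R) (X : J -> Lam2) :
    pairing K (\sum_j c j *: X j) = \sum_j c j *: pairing K (X j).
  exact: (lin_fun_sum (pairing_linear K)).
have pairing_sum1 (J : finType) (X : J -> Lam2) :
    pairing K (\sum_j X j) = \sum_j pairing K (X j).
  by under eq_bigr do rewrite -[X _]scale1r; rewrite pairing_sum;
     under eq_bigr do rewrite scale1r.
rewrite /tmul pairing_sum1.
under eq_bigr do rewrite pairing_sum.
rewrite exchange_big; apply: eq_bigr => q _ /=.
rewrite scaler_sumr; apply: eq_bigr => p _.
by rewrite scalerA; congr (_ *: _); rewrite mulrA mulrC.
Qed.

Lemma lin_ext_vec_cons (h : seq V -> A) x v : alternating_form h -> x \in W ->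
  lin_ext h (wedge (vec W x) v) = lin_ext (fun s => h (x :: s)) v.
Proof. by case=> hl ha xW; exact: (lin_ext_vec hl ha [::] v xW). Qed.

Lemma sum_wedge_lin_ext (h : seq V -> A) v w :
  \sum_X v X *: lin_ext h (wedge (mn X) w) = lin_ext h (wedge v w).
Proof.
rewrite wedge_suml lin_ext_sum; apply: eq_bigr => X _.
by rewrite lin_extZ.
Qed.

Lemma tensE v w p : tens v w p = v p.1 * w p.2.
Proof. by rewrite ffunE. Qed.

(** Multiplication by a primitive element on the left is dual to removing the
    first letter, from the left word or, with the sign of the super tensor product,
    from the right one. *)
Lemma pairing_tmul_primitive K x Z : alternating_biform K -> x \in W ->
  pairing K (tmul (tens (vec W x) (lam1 W) + tens (lam1 W) (vec W x)) Z) =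
  pairing (fun s t => K (x :: s) t) Z +
  pairing (fun s t => (-1) ^+ size s *: K s (x :: t)) Z.
Proof.
move=> [Kl Kr] xW; rewrite pairing_tmul -big_split; apply: eq_bigr => q _ /=.
rewrite -scalerDr; congr (_ *: _).
under eq_bigr => p _ do rewrite ffunE !tensE mulrDr scalerDl.
rewrite big_split; congr (_ + _).
  rewrite -(pair_bigA _ (fun X Y => ((-1) ^+ (#|Y| * #|q.1|) *
    (vec W x X * (lam1 W) Y)) *: pairing K (tens (wedge (mn X) (mn q.1))
      (wedge (mn Y) (mn q.2))))) /=.
  under eq_bigr => X _.
    under eq_bigr => Y _ do rewrite mulrA [_ * lam1 W Y]mulrC -scalerA.
    rewrite mon_sum cards0 mul0n expr0 mul1r wedge1l pairing_tens_monr.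
    over.
  by rewrite sum_wedge_lin_ext lin_ext_vec_cons ?lin_ext_mon.
rewrite -(pair_bigA _ (fun X Y => ((-1) ^+ (#|Y| * #|q.1|) *
    ((lam1 W) X * vec W x Y)) *: pairing K (tens (wedge (mn X) (mn q.1))
      (wedge (mn Y) (mn q.2))))) /= exchange_big /=.
under eq_bigr => Y _.
  under eq_bigr => X _ do rewrite mulrCA -scalerA.
  rewrite mon_sum wedge1l pairing_tens_monl.
  have -> : (-1) ^+ (#|Y| * #|q.1|) * vec W x Y = (-1) ^+ #|q.1| * vec W x Y.
    rewrite [vec W x Y]sum_ffunE.
    have [/cards1P[i ->]|Y1] := boolP (#|Y| == 1%N); first by rewrite cards1 mul1n.
    rewrite big1 ?mulr0 // => i _; rewrite !ffunE.
    by case: eqP => [Yi|]; rewrite ?scaler0 //; move: Y1; rewrite Yi cards1.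
  rewrite -scalerA.
  over.
rewrite -scaler_sumr sum_wedge_lin_ext lin_ext_vec_cons ?lin_ext_mon //.
by rewrite size_map -cardE.
Qed.

Lemma form_cons (h : seq V -> A) x :
  alternating_form h -> alternating_form (fun s => h (x :: s)).
Proof.
by case=> hl ha; split=> [c y z s1 s2|y z s1 s2];
  [exact: (hl c y z (x :: s1))|exact: (ha y z (x :: s1))].
Qed.

Lemma form_scale_size (c : nat -> R) (h : seq V -> A) :
  alternating_form h -> alternating_form (fun s => c (size s) *: h s).
Proof.
case=> hl ha; split=> [d y z s1 s2|y z s1 s2]; rewrite !size_cat /=.
  by rewrite hl scalerDr !scalerA mulrC.
by rewrite ha scalerN.
Qed.

Lemma pairing_coprod_wedge K (s : seq V) : alternating_biform K -> {subset s <= W} ->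
  pairing K (\big[@tmul R V W/tens (lam1 W) (lam1 W)]_(x <- s)
    (tens (vec W x) (lam1 W) + tens (lam1 W) (vec W x))) = shuffle K s.
Proof.
elim: s K => [|x s IHs] K KK sW.
  by rewrite big_nil pairing_tens_monr lin_ext_mon /basis_seq enum_set0.
have sW' : {subset s <= W} by move=> y ys; rewrite sW // in_cons ys orbT.
rewrite big_cons pairing_tmul_primitive ?sW ?mem_head //=.
case: KK => Kl Kr; congr (_ + _); apply: IHs => //; split=> [v|u].
- exact: (form_cons x (Kl v)).
- exact: Kr.
- exact: (form_scale_size (fun n => (-1) ^+ n) (Kl (x :: v))).
- exact: (form_scale_size (fun _ => (-1) ^+ size u) (form_cons x (Kr u))).
Qed.

(** The coproduct of a monomial is the product of the coproducts of its primitive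
    factors, and each factor contributes one step of the recursion for shuffles. *)
Lemma pairing_coprod K X : alternating_biform K ->
  pairing K (coprod (mn X)) = shuffle K (basis_seq X).
Proof.
move=> KK; rewrite /coprod lin_ext_mon pairing_coprod_wedge // => y /mapP[i _ ->].
by rewrite vbasis_mem // mem_nth // size_tuple.
Qed.

End Pairing.

(** * Left multiplication by an odd element in the enveloping algebra *)

Lemma form_lin (R : realType) (V : vectType R) (A B : lmodType R) (f : A -> B)
    (h : seq V -> A) :
  (forall (c : R) x y, f (c *: x + y) = c *: f x + f y) ->
  alternating_form h -> alternating_form (fun s => f (h s)).
Proof.
move=> fl [hl ha]; split=> [c x y s1 s2|x y s1 s2]; first by rewrite hl fl.
by rewrite ha -scaleN1r (lin_funZ fl) scaleN1r.
Qed.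

Lemma antisym_form (R : realType) (V : vectType R) (A : lmodType R)
    (h : seq V -> A) (c : nat -> R) :
  Defs.multilinear h -> alternating_form (fun s => c (size s) *: antisym h s).
Proof.
move=> hl; apply: form_scale_size; split; first exact: antisym_multilinear.
exact: antisym_alternating.
Qed.

Section EnvelopingIdentity.
Variables (R : realType) (g : vectType R) (L : lie_superalgebra g).
Variables (Ug : algType R) (iU : g -> Ug).
Hypothesis iU_rep : super_rep L iU.
Local Notation odd_g := (part L true).
Local Notation T := (subvs_of odd_g).
Local Notation S := (skew_fun T Ug).
Local Notation emb := (map (vsval : T -> g)).
Local Notation xi := (@odd_letter R g L Ug iU).

Let iU_lin : forall (c : R) x y, iU (c *: x + y) = c *: iU x + iU y :=
  iU_rep.1.

Lemma gamma_form_form : alternating_form (gamma_form iU).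
Proof.
exact: (antisym_form (fun n => (n`!%:R)^-1) (prod_multilinear iU_lin)).
Qed.

Lemma gamma_formE (s : seq T) :
  gamma_form iU (emb s) = ((size s)`!%:R)^-1 *: (xi ^+ size s) s.
Proof. by rewrite /gamma_form size_map antisym_prod. Qed.

Variable a : g.

Lemma theta_formE :
  theta_form L a = fun s => theta_coef R (size s) *: antisym (ads L a) s.
Proof.
by apply/funext => s; rewrite /theta_form /theta_coef; case: ifP; rewrite ?scale0r.
Qed.

Lemma eps_formE :
  eps_form L a = fun s => eps_coef R (size s) *: antisym (ads L a) s.
Proof.
by apply/funext => s; rewrite /eps_form /eps_coef; case: ifP; rewrite ?scale0r.
Qed.

Lemma theta_form_form : alternating_form (theta_form L a).
Proof. rewrite theta_formE; exact: antisym_form (ads_multilinear L a). Qed.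

Lemma eps_form_form : alternating_form (eps_form L a).
Proof. rewrite eps_formE; exact: antisym_form (ads_multilinear L a). Qed.

Hypothesis a_odd : a \in odd_g.
Local Notation ad := (@ad_power R g L Ug iU a).

Lemma theta_form_even s : {subset s <= odd_g} -> theta_form L a s \in part L false.
Proof.
move=> so; rewrite theta_formE; have := antisym_ads_part a_odd so.
rewrite /theta_coef; case: ifP => os; last by rewrite scale0r mem0v.
exact: memvZ.
Qed.

Lemma eps_form_odd s : {subset s <= odd_g} -> eps_form L a s \in odd_g.
Proof.
move=> so; rewrite eps_formE; have := antisym_ads_part a_odd so.
rewrite /eps_coef; case: ifP => os; first by rewrite scale0r mem0v.
exact: memvZ.
Qed.

(** The form attached to theta_1(v_(1)) gamma(v_(2)). *)
Definition theta_gamma (s t : seq g) : Ug :=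
  iU (theta_form L a s) * gamma_form iU t.

(** The form attached to gamma(eps(v_(1)) /\ v_(2)). *)
Definition gamma_eps (s t : seq g) : Ug := gamma_form iU (eps_form L a s :: t).

Lemma theta_gamma_biform : alternating_biform theta_gamma.
Proof.
split=> t.
  apply: (form_lin (f := fun y => iU y * gamma_form iU t));
    last exact: theta_form_form.
  by move=> c x y; rewrite iU_lin mulrDl scalerAl.
apply: (form_lin (f := fun y => iU (theta_form L a t) * y));
  last exact: gamma_form_form.
by move=> c x y; rewrite mulrDr scalerAr.
Qed.

Lemma gamma_eps_biform : alternating_biform gamma_eps.
Proof.
split=> t; last exact: form_cons gamma_form_form.
apply: (form_lin (f := fun y => gamma_form iU (y :: t))); last exact: eps_form_form.
by move=> c x y; have [gl _] := gamma_form_form; exact: (gl c x y [::]).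
Qed.

Lemma shuffle_theta_gamma (s : seq T) (n := size s) :
  shuffle theta_gamma (emb s) =
  (\sum_(k < n.+1) (theta_coef R k / (n - k)`!%:R) *: (ad k * xi ^+ (n - k)) : S) s.
Proof.
rewrite shuffle_map shuffle_graded skew_sumE; apply: eq_bigr => k _.
rewrite skew_scaleE skew_mulE -shuffleZ.
apply: eq_shuffle => u v uv; rewrite -/n in uv.
case: eqP => [uk|/eqP uk]; last by rewrite ad_power_neq // mul0r scaler0.
have -> : (n - k = size v)%N by rewrite -uv uk addKn.
rewrite /theta_gamma gamma_formE theta_formE size_map -uk ad_powerE.
have -> : iU (theta_coef R (size u) *: antisym (ads L a) (emb u)) =
    theta_coef R (size u) *: iU (antisym (ads L a) (emb u)).
  exact: lin_funZ iU_lin _ _.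
by rewrite -scalerAl -scalerAr scalerA.
Qed.

(** The derivative of the exponential in the direction y is the sum of all
    insertions of y; the value of eps may be put in place of y because it is again odd. *)
Lemma gamma_form_cons (y : T) (v : seq T) (l := size v) :
  gamma_form iU (vsval y :: emb v) = (l.+1`!%:R)^-1 *:
    (\sum_(i < l.+1) (-1) ^+ i *:
       (xi ^+ i * (at_nil (iU (vsval y)) * xi ^+ (l - i))) : S) v.
Proof.
rewrite -[vsval y :: _]/(emb (y :: v)) gamma_formE; congr (_ *: _).
by rewrite -[LHS]/(shift y (xi ^+ l.+1) v) shift_letterX.
Qed.

(** Only even k contribute, and the twist in shuffle_insert is then trivial. *)
Lemma shuffle_gamma_eps (s : seq T) (n := size s) :
  shuffle gamma_eps (emb s) =
  (\sum_(k < n.+1) (eps_coef R k / ((n - k).+1)`!%:R) *: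
    \sum_(i < (n - k).+1) (-1) ^+ i *: (xi ^+ i * (ad k * xi ^+ (n - k - i))) : S) s.
Proof.
rewrite shuffle_map shuffle_graded skew_sumE; apply: eq_bigr => k _.
rewrite skew_scaleE skew_sumE.
under [in RHS]eq_bigr => i _ do rewrite skew_scaleE -shuffle_insert -shuffleZ.
rewrite -shuffle_sum -shuffleZ.
apply: eq_shuffle => u v uv; rewrite -/n in uv.
case: eqP => [uk|/eqP uk]; last first.
  rewrite ad_power_neq // big1 ?scaler0 // => i _.
  rewrite (_ : at_nil 0 = 0 :> S); last by apply/funext => -[].
  by rewrite mul0r mulr0 [_ v]/(0 : Ug) scaler0.
have -> : (n - k = size v)%N by rewrite -uv uk addKn.
rewrite -uk ad_powerE /gamma_eps.
have eo : eps_form L a (emb u) \in odd_g by apply: eps_form_odd; exact: emb_odd.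
rewrite -(vsprojK eo) gamma_form_cons vsprojK // eps_formE size_map.
have -> : iU (eps_coef R (size u) *: antisym (ads L a) (emb u)) =
    eps_coef R (size u) *: iU (antisym (ads L a) (emb u)).
  exact: lin_funZ iU_lin _ _.
rewrite (_ : forall c y, at_nil (c *: y) = c *: at_nil y :> S); last first.
  by move=> c y; apply/funext => -[|x w]; rewrite skew_scaleE //= scaler0.
have [ou|eu] := boolP (odd (size u)).
  rewrite /eps_coef ou !mul0r !scale0r skew_sumE big1 ?scaler0 // => i _.
  by rewrite mul0r mulr0 scaler0.
rewrite skew_sumE mulrC -scalerA !scaler_sumr; apply: eq_bigr => i _.
rewrite skew_scaleE -scalerAl -scalerAr skew_scaleE.
have -> : parity_twist (size u) (xi ^+ i) = xi ^+ i.
  apply/funext => w; rewrite /parity_twist -signr_odd oddM (negbTE eu).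
  by rewrite scale1r.
by rewrite !scalerA -!mulrA [_ * (-1) ^+ i]mulrC.
Qed.

(** Everything is now expressed in the generic odd element and the iterated
    brackets, so tanh_sinh_identity applies. *)
Lemma odd_mul_gamma_form (s : seq T) : iU a * gamma_form iU (emb s) =
  shuffle theta_gamma (emb s) + shuffle gamma_eps (emb s).
Proof.
rewrite shuffle_theta_gamma shuffle_gamma_eps -skew_addE.
rewrite (tanh_sinh_identity (ad_powerS iU_rep a_odd)).
by rewrite skew_scaleE ad_power0 mul_at_nil_l gamma_formE -scalerAr.
Qed.

Lemma basis_seq_odd X : {subset basis_seq (W := odd_g) X <= odd_g}.
Proof. by move=> y /mapP[i _ ->]; rewrite vbasis_mem // mem_nth // size_tuple. Qed.

(** Both sides are linear in v, which reduces the identity to basis monomials. *)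
Lemma odd_mul_gamma v : iU a * gamma iU v =
  \sum_p coprod v p *: (iU (theta1 L a (mon p.1)) * gamma iU (mon p.2)) +
  \sum_p coprod v p *:
    gamma iU (wedge (vec odd_g (epsilon L a (mon p.1))) (mon p.2)).
Proof.
have K1E p : iU (theta1 L a (mon p.1)) * gamma iU (mon p.2) =
    theta_gamma (basis_seq p.1) (basis_seq p.2).
  by rewrite /theta1 /gamma !lin_ext_mon.
have K2E p : gamma iU (wedge (vec odd_g (epsilon L a (mon p.1))) (mon p.2)) =
    gamma_eps (basis_seq p.1) (basis_seq p.2).
  rewrite /epsilon lin_ext_mon /gamma lin_ext_vec_cons ?lin_ext_mon //.
    exact: gamma_form_form.
  by apply: eps_form_odd; exact: basis_seq_odd.
under eq_bigr do rewrite K1E.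
under [X in _ + X]eq_bigr do rewrite K2E.
rewrite -/(pairing theta_gamma (coprod v)) -/(pairing gamma_eps (coprod v)).
have -> : coprod v = \sum_X v X *: coprod (mon X).
  by rewrite {1}/coprod; apply: eq_bigr => X _; rewrite /coprod lin_ext_mon.
rewrite !(lin_fun_sum (pairing_linear _)) -big_split /= mulr_sumr.
apply: eq_bigr => X _; rewrite -scalerAr -scalerDr; congr (_ *: _).
rewrite !pairing_coprod; [|exact: gamma_eps_biform|exact: theta_gamma_biform].
rewrite -[map _ (enum X)]/(basis_seq X).
have -> : basis_seq X = emb (map (vsproj odd_g) (basis_seq X)).
  rewrite -map_comp -[LHS]map_id; apply/eq_in_map => y yX /=.
  by rewrite vsprojK // (basis_seq_odd yX).
exact: odd_mul_gamma_form.
Qed.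

End EnvelopingIdentity.

Theorem theorem2p30 (R : realType) (n : nat) (G : lieGroupType R n)
    (g : vectType R) (H : harish_chandra G g)
    (Ug : algType R) (iU : g -> Ug) (enveloping : is_enveloping H iU)
    (U : set G) (openU : open U) (a : g) (odd_a : a \in part H true)
    (p : bool) (f : {linear Lambda R (part H true) -> (G -> R^o)})
    (homf : hom_ext U p f)
    (F : {linear Ug -> (G -> R^o)}) (sheafF : sheaf H iU U p F)
    (Ff : forall v, F (gamma iU v) = f v) :
  forall (v : Lambda R (part H true)) (x : G), U x ->
    phihat H iU p true a F (gamma iU v) x =
      convolution (phi0 H) (theta1 H (Ad H x^-1%g a)) p f v x
      + (-1) ^+ p * f (convolution (fun b w => wedge (vec (part H true) b) w)
                            (epsilon H (Ad H x^-1%g a)) false id v) x.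
Proof.
move=> v x Ux; rewrite /phihat andbT; set b := Ad H x^-1%g a.
have b_odd : b \in part H true by exact: Ad_part.
have iU_rep : super_rep H iU by case: enveloping.
have [_ F_phi0 _] := sheafF.
have sum_fun_app (J : finType) (k : J -> G -> R^o) :
    (\sum_j k j) x = \sum_j k j x.
  by elim/big_rec2: _ => // j y z _ <-.
rewrite (odd_mul_gamma iU_rep b_odd) linearD -[(_ + _) x]/(F _ x + F _ x) mulrDr.
congr (_ + _); last first.
  congr (_ * _); rewrite -Ff; congr (F _ x).
  rewrite /convolution /gamma lin_ext_sum; apply: eq_bigr => q _.
  by rewrite lin_extZ mul0n expr0 mul1r.
rewrite linear_sum /convolution !sum_fun_app mulr_sumr; apply: eq_bigr => q _.
rewrite linearZ -![(_ *: _) x]/(_ *: (_ : R^o)) -Ff.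
have tE : theta1 H b (mon q.1) = theta_form H b (basis_seq q.1).
  by rewrite /theta1 lin_ext_mon.
rewrite -F_phi0 //; last first.
  by rewrite tE; apply: theta_form_even => //; exact: basis_seq_odd.
(* On odd monomials the sign of the convolution is (-1)^p; on even ones theta_1
   vanishes and so do both sides. *)
have [oq|eq] := boolP (odd #|q.1|).
  have -> : (-1) ^+ (p * #|q.1|) = (-1) ^+ p :> R.
    by rewrite -signr_odd oddM oq andbT oddb.
  by rewrite -scalerA.
have -> : theta1 H b (mon q.1) = 0.
  by rewrite tE /theta_form size_map -cardE (negbTE eq).
rewrite (lin_fun0 iU_rep.1) mul0r linear0 -[LHS]/((-1) ^+ p * (coprod v q * 0)).
by rewrite !mulr0 -[RHS]/(_ * 0) mulr0.
Qed.
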